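(* For every integer $n\ge 1$ there is a constant $\mathsf{C}_n>0$, depending only on $n$, such that the following holds. Let $d\ge n$ be an integer, let $p\in\mathbb{R}[x_1,\ldots,x_d]$ be a homogeneous polynomial of degree $2n$, and let $p_{\min}=\min_{x\in S^{d-1}}p(x)$ and $p_{\max}=\max_{x\in S^{d-1}}p(x)$, with $p_{\max}>p_{\min}$. Then for every integer $\ell\ge \mathsf{C}_n d$, $$1\;\le\;\frac{p_\ell-p_{\min}}{p_{\max}-p_{\min}}\;\le\;1+\Bigl(\frac{\mathsf{C}_n d}{\ell}\Bigr)^2 .$$
   Context: $S^{d-1}=\{x\in\mathbb{R}^d: x_1^2+\cdots+x_d^2=1\}$. A real polynomial $g$ in $d$ variables is a sum of squares of degree $\ell$ on $S^{d-1}$ (or $\ell$-sos on $S^{d-1}$) if there are finitely many polynomials $u_j\in\mathbb{R}[x_1,\ldots,x_d]$ with $\deg u_j\le \ell$ such that $g(x)=\sum_j u_j(x)^2$ for all $x\in S^{d-1}$. The level-$\ell$ sum-of-squares bound is $$p_\ell=\min\{\gamma\in\mathbb{R}: \gamma-p \text{ is a sum of squares of degree } \ell \text{ on } S^{d-1}\}.$$ *)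

(* Defs.v *)
(* mpoly must be imported before any file of mathcomp-analysis: the converse
   order fails to parse. *)
From mathcomp Require Import all_boot all_order all_algebra.
From mathcomp Require Import mpoly.
From mathcomp Require Import classical_sets reals.

Set Implicit Arguments.
Unset Strict Implicit.
Unset Printing Implicit Defensive.

Import Order.TTheory GRing.Theory Num.Theory.

Local Open Scope ring_scope.
Local Open Scope classical_set_scope.

(* The sphere S^(d-1); points of R^d are functions 'I_d -> R, the type of the
   valuations accepted by p.@[x]. *)
Definition sphere (R : realType) (d : nat) : set ('I_d -> R) :=
  [set x | \sum_(i < d) x i ^+ 2 = 1].

(* A minimum is attained, unlike [inf A]. *)
Definition is_min (R : realType) (A : set R) (m : R) : Prop :=
  A m /\ lbound A m.

Definition is_max (R : realType) (A : set R) (m : R) : Prop :=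
  A m /\ ubound A m.

Definition sphere_values (R : realType) (d : nat) (p : {mpoly R[d]}) : set R :=
  [set p.@[x] | x in @sphere R d].

(* Since msize u = deg u + 1 for u != 0 and msize 0 = 0, the condition
   msize u <= l.+1 says deg u <= l.  The equality with the sum of squares is
   required on the sphere only, not as polynomials. *)
Definition sos_on_sphere (R : realType) (d l : nat) (g : {mpoly R[d]}) : Prop :=
  exists2 us : seq {mpoly R[d]},
    forall u, u \in us -> (msize u <= l.+1)%N &
    forall x, @sphere R d x -> g.@[x] = \sum_(u <- us) u.@[x] ^+ 2.

(* pl = p_l, as a relation because the minimum need not exist for every l. *)
Definition is_sos_bound (R : realType) (d l : nat) (p : {mpoly R[d]}) (pl : R) :
    Prop :=
  is_min [set gamma | sos_on_sphere l (gamma%:MP - p)] pl.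

(* Main.v *)
Require Import Defs.
From HB Require Import structures.
From mathcomp Require Import all_boot all_order all_algebra.
From mathcomp Require Import mpoly.
From mathcomp Require Import classical_sets reals.
From mathcomp Require Import boolp topology normedtype sequences complex.
From mathcomp Require Import ring lra zify.

Set Implicit Arguments.
Unset Strict Implicit.
Unset Printing Implicit Defensive.

Import Order.TTheory GRing.Theory Num.Theory numFieldNormedType.Exports.

Local Open Scope ring_scope.

(** Put F = p_max - p, which lies between 0 and D = p_max - p_min on the sphere;
    it suffices to show that F + eps D is a sum of squares of degree l on the sphere
    for some eps of order (d / l) ^ 2.  The tool is an operator
      K h (x) = integral of q(<x, z>) ^ 2 h(z) over z in the sphere
    where q is an even polynomial of degree at most l, normalized so that K 1 = 1.
    If h >= 0 then K h is visibly l-sos.  If K is close to the identity on forms of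
    degree 2 n, say |K h - h| <= delta |h| in the uniform norm, then the Neumann
    series for the inverse of K applied to F stays above - 2 delta D, so that
    F + 2 delta D = K (something nonnegative) is l-sos
    ([approx_identity], [sos_of_nonneg_add]).

    Two facts give delta = O((d / l) ^ 2) with a constant depending on n only.
    First ([reflection_mean_bound]), K is invariant under reflections, so
    h(z) - h(x) may be averaged over the reflection fixing x; on the great circle
    through x and z this average is, for a form of degree 2 n, at most a
    constant C_n times |h| (1 - <x, z> ^ 2), a one-variable estimate in which the
    dimension does not enter.  Second ([concentrated_zonal_poly]), q can be chosen so
    that the mean of 1 - <x, z> ^ 2 under q(<x, z>) ^ 2 is O((d / l) ^ 2): in the basis
    of orthonormal Gegenbauer polynomials, multiplication by t is a Jacobi matrix with
    entries 1/2 + O((d / k) ^ 2), and q is a slowly varying combination of the basis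
    elements of degrees from about l/2 to l.

    The integral is realized as a finite sum, exact in the degrees that occur
    ([sphere_design_exists]).  Its nodes are those of a product Gauss-Hermite
    cubature of R ^ d, projected to the sphere; the one-dimensional quadrature is the
    spectral measure of a truncated Jacobi matrix, and the invariance of the sphere
    is recovered from Stein's identity E[y_i f(y)] = E[d_i f (y)].

    Finally, the limit in the Neumann series and the fact that the minimum p_l is
    attained both rest on the closedness of the cone of l-sos functions on the
    sphere ([sos_on_sphere_closed]). *)

(** * Finite measures *)

Definition expect (R : pzRingType) (T : Type) (I : finType) (W : I -> R) (y : I -> T)
  (f : T -> R) : R := \sum_i W i * f (y i).

Section Expect.
Context {R : comNzRingType} {T : Type} {I : finType} (W : I -> R) (y : I -> T).

Lemma eq_expect f g : f =1 g -> expect W y f = expect W y g.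
Proof. by move=> fg; apply: eq_bigr => i _; rewrite fg. Qed.

Lemma expectD f g :
  expect W y (fun x => f x + g x) = expect W y f + expect W y g.
Proof. by rewrite -big_split; apply: eq_bigr => i _; rewrite mulrDr. Qed.

Lemma expectZ c f : expect W y (fun x => c * f x) = c * expect W y f.
Proof. by rewrite mulr_sumr; apply: eq_bigr => i _; rewrite mulrCA. Qed.

Lemma expectB f g :
  expect W y (fun x => f x - g x) = expect W y f - expect W y g.
Proof. by rewrite -sumrB; apply: eq_bigr => i _; rewrite mulrBr. Qed.

Lemma expect_sum (J : Type) (r : seq J) (F : J -> T -> R) :
  expect W y (fun x => \sum_(j <- r) F j x) = \sum_(j <- r) expect W y (F j).
Proof. by rewrite exchange_big; apply: eq_bigr => i _; rewrite mulr_sumr. Qed.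

End Expect.

(** * Gauss-Hermite quadrature *)

(** Diagonalize A over the complex numbers in a unitary basis: the nodes are the
    eigenvalues, and the weights the squared moduli of the coordinates of the
    first basis vector. *)
Lemma symmetric_spectral_measure (R : rcfType) (n : nat) (A : 'M[R]_n.+1) :
  A^T = A ->
  exists w lam : 'I_n.+1 -> R, (forall j, 0 <= w j) /\
    forall f : {poly R}, \sum_j w j * f.[lam j] = horner_mx A f 0 0.
Proof.
move=> symA; pose AC : 'M[R[i]]_n.+1 := map_mx (real_complex R) A.
have hA : AC \is hermsymmx.
  apply: realsym_hermsym.
    apply/is_hermitianmxP; rewrite expr0 scale1r map_mx_id // /AC map_trmx.
    by rewrite symA.
  by apply/mxOverP => i j; rewrite mxE complex_real.
have := hermitian_spectral_diag_real hA.
have := hA => /hermitian_normalmx/orthomx_spectralP.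
have := spectral_unitarymx AC.
move: (spectralmx AC) (spectral_diag AC) => P D uP eqA realD.
have {}realD j : (complex.Re (D 0 j))%:C%C = D 0 j.
  by apply: RRe_real; move/mxOverP: realD; apply.
exists (fun j => complex.Re `|P j 0| ^+ 2), (fun j => complex.Re (D 0 j)).
split=> [j|f]; first by rewrite sqr_ge0.
apply: (@complexI R); rewrite rmorph_sum.
under eq_bigr do rewrite rmorphM.
have -> : (horner_mx A f 0 0)%:C%C = horner_mx AC (map_poly (real_complex R) f) 0 0.
  by rewrite -map_horner_mx mxE.
rewrite eqA horner_mx_uconjC ?unitarymx_unit // horner_mx_diag.
rewrite invmx_unitary // mxE; apply: eq_bigr => j _.
have norm2 : (complex.Re `|P j 0| ^+ 2)%:C%C = `|P j 0| ^+ 2.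
  by rewrite rmorphXn [X in X ^+ 2]RRe_real ?normr_real.
rewrite mul_mx_diag !mxE -[D 0 j]realD horner_map realD mulrAC [X in X * _]norm2.
by rewrite normCK [P j 0 * _]mulrC.
Qed.

Fixpoint gauss_moment (R : nzRingType) (k : nat) : R :=
  match k with
  | 0 => 1
  | 1 => 0
  | k'.+2 => k'.+1%:R * gauss_moment R k'
  end.

(** The probabilists' normalization: monic, with weight exp (- t ^ 2 / 2). *)
Fixpoint hermite (R : nzRingType) (k : nat) : {poly R} :=
  match k with
  | 0 => 1
  | 1 => 'X
  | (k'.+1 as k1).+1 => 'X * hermite R k1 - hermite R k' *+ k'.+1
  end.

Arguments hermite R k : simpl never.

Lemma hermiteSS (R : nzRingType) k :
  hermite R k.+2 = 'X * hermite R k.+1 - hermite R k *+ k.+1.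
Proof. by []. Qed.

Lemma deriv_hermite (R : comNzRingType) k :
  (hermite R k.+1)^`() = hermite R k *+ k.+1.
Proof.
elim: k {-2}k (leqnn k) => [|m IH] [|k] // lekm; rewrite ?derivX //.
rewrite hermiteSS derivB derivM derivX mul1r derivMn IH //.
case: k lekm => [|k] lekm; first by rewrite derivC mul0rn subr0 mulr1n mulr1 mulr2n.
rewrite (IH k); last by lia.
rewrite [RHS]mulrS -addrA; congr (_ + _).
by rewrite hermiteSS mulrnBl mulrnAr.
Qed.

Lemma hermite_monic (R : nzRingType) k :
  size (hermite R k) = k.+1 /\ hermite R k \is monic.
Proof.
elim: k {-2}k (leqnn k) => [|m IH] [|[|k]] // lekm;
  rewrite ?size_poly1 ?monic1 ?size_polyX ?monicX //.
have [s1 m1] := IH k.+1 lekm; have [s0 _] := IH k (ltnW lekm).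
have s1X : size ('X * hermite R k.+1) = k.+3.
  by rewrite -commr_polyX size_mulX ?s1 // -size_poly_eq0 s1.
have lt_s : (size (- (hermite R k *+ k.+1)) < size ('X * hermite R k.+1)%R)%N.
  by rewrite s1X size_polyN -scaler_nat (leq_ltn_trans (size_scale_leq _ _)) ?s0.
rewrite hermiteSS; split; first by rewrite size_polyDl.
by rewrite monicE lead_coefDl // -commr_polyX lead_coefMX -monicE.
Qed.

Definition hermite_jacobi (R : rcfType) (n : nat) : 'M[R]_n.+1 := \matrix_(i, j)
  (Num.sqrt j%:R *+ (j == i.+1 :> nat) + Num.sqrt i%:R *+ (i == j.+1 :> nat)).

(** Multiplication by ['X] sends the normalized Hermite polynomial of degree k
    to combinations of its two neighbours with the entries of this matrix; below
    the cut-off n, He_k of the matrix thus sends the first basis vector to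
    sqrt (k!) times the k-th. *)
Lemma horner_hermite_jacobi (R : rcfType) (n k : nat) (i : 'I_n.+1) : (k <= n)%N ->
  horner_mx (hermite_jacobi R n) (hermite R k) i 0 = Num.sqrt (k`!%:R) *+ (i == k :> nat).
Proof.
set A := hermite_jacobi R n.
elim: k {-2}k (leqnn k) i => [|m IH] [|[|k]] // lekm i lekn.
- by rewrite rmorph1 mxE fact0 sqrtr1 -val_eqE.
- by rewrite rmorph1 mxE fact0 sqrtr1 -val_eqE.
- by rewrite /= horner_mx_X mxE /= sqrtr0 mul0rn add0r; case: eqP => // ->.
rewrite hermiteSS rmorphB rmorphM rmorphMn /= horner_mx_X mxE [X in _ + X]mxE mulmxnE mxE.
have lekm' : (k <= m)%N by lia.
have lekn' : (k.+1 <= n)%N by lia.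
rewrite (IH k lekm' i (ltnW lekn')).
rewrite (bigD1 (Ordinal (lekn' : k.+1 < n.+1)%N)) //= big1 ?addr0; last first.
  move=> j nej; rewrite (IH k.+1 lekm _ lekn').
  by move: nej; rewrite -val_eqE /= => /negPf ->; rewrite mulr0n mulr0.
rewrite (IH k.+1 lekm _ lekn') eqxx mulr1n !mxE /= mulrDl.
have fS j : Num.sqrt (j.+1`!%:R : R) = Num.sqrt j.+1%:R * Num.sqrt j`!%:R.
  by rewrite factS natrM sqrtrM ?ler0n.
have -> : (Num.sqrt k.+1%:R *+ (k.+1 == i.+1) * Num.sqrt k.+1`!%:R : R)
    = Num.sqrt k`!%:R *+ (i == k :> nat) *+ k.+1.
  rewrite fS eqSS eq_sym; case: eqP => _; rewrite ?mulr0n ?mul0r ?mul0rn //.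
  by rewrite !mulr1n mulrA -expr2 sqr_sqrtr ?ler0n // mulr_natl.
rewrite addrAC subrr add0r; case: eqP => [->|_]; rewrite ?mulr0n ?mul0r //.
by rewrite !mulr1n -fS.
Qed.

(** The Hermite polynomials being a monic basis, a functional that kills
    He_1, ..., He_n satisfies the Gaussian integration by parts
    E[t f(t)] = E[f'(t)] for f of degree less than n, as
    He_(m+1) = t He_m - He_m'. *)
Lemma hermite_stein (R : rcfType) (n : nat) (L : {poly R} -> R) m (f : {poly R}) :
  (forall g h, L (g + h) = L g + L h) -> (forall c g, L (c *: g) = c * L g) ->
  (forall k, (k < n)%N -> L (hermite R k.+1) = 0) ->
  (m <= n)%N -> (size f <= m)%N -> L ('X * f - f^`()) = 0.
Proof.
move=> LD LZ LHe; elim: m f => [|m IH] f lemn.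
  rewrite leqn0 size_poly_eq0 => /eqP ->.
  by rewrite mulr0 deriv0 subr0 -(scale0r 0) LZ mul0r.
move=> sf; have [sH mH] := hermite_monic R m.
pose g := f - f`_m *: hermite R m.
have sg : (size g <= m)%N.
  apply/leq_sizeP => j; rewrite leq_eqVlt => /orP[/eqP <-|ltmj].
    rewrite coefB coefZ; have := mH; rewrite monicE lead_coefE sH /= => /eqP ->.
    by rewrite mulr1 subrr.
  rewrite coefB coefZ (nth_default _ (leq_trans sf ltmj)).
  have -> : (hermite R m)`_j = 0 by rewrite nth_default ?sH.
  by rewrite mulr0 subr0.
have -> : f = g + f`_m *: hermite R m by rewrite subrK.
have -> : 'X * (g + f`_m *: hermite R m) - (g + f`_m *: hermite R m)^`()
    = ('X * g - g^`()) + f`_m *: ('X * hermite R m - (hermite R m)^`()).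
  by rewrite derivD derivZ scalerBr -!mul_polyC; ring.
rewrite LD IH ?(ltnW lemn) // LZ add0r.
suff -> : 'X * hermite R m - (hermite R m)^`() = hermite R m.+1.
  by rewrite LHe ?mulr0.
by case: (m) => [|k]; rewrite ?deriv_hermite // mulr1 derivC subr0.
Qed.

(** The spectral measure of the truncated Hermite Jacobi matrix kills
    He_1, ..., He_n, and Stein's identity determines the moments. *)
Lemma gauss_hermite_quadrature (R : rcfType) (n : nat) :
  exists w lam : 'I_n.+1 -> R, (forall j, 0 <= w j) /\
    forall k, (k <= n)%N -> \sum_j w j * lam j ^+ k = gauss_moment R k.
Proof.
have symA : (hermite_jacobi R n)^T = hermite_jacobi R n.
  by apply/matrixP => i j; rewrite !mxE addrC.
have [w [lam [w_ge0 wP]]] := symmetric_spectral_measure symA.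
exists w, lam; split=> //.
pose L (f : {poly R}) := \sum_j w j * f.[lam j].
have LD f g : L (f + g) = L f + L g.
  by rewrite /L -big_split; apply: eq_bigr => j _; rewrite hornerD mulrDr.
have LZ c f : L (c *: f) = c * L f.
  by rewrite /L mulr_sumr; apply: eq_bigr => j _; rewrite hornerZ mulrCA.
have L1 : L 1 = 1 by rewrite /L wP rmorph1 mxE.
have LHe k : (k < n)%N -> L (hermite R k.+1) = 0.
  by move=> ltkn; rewrite /L wP (@horner_hermite_jacobi _ _ k.+1).
have LX k : (k <= n)%N -> L 'X^k = gauss_moment R k.
  elim: k {-2}k (leqnn k) => [|m IH] [|[|k]] // lekm lekn.
  - by rewrite expr1; apply: (LHe 0%N).
  have := hermite_stein (f := 'X^(k.+1)) LD LZ LHe lekn.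
  rewrite size_polyXn => /(_ (leqnn _)).
  rewrite -exprS derivXn => /eqP; rewrite -scaler_nat -scaleNr LD LZ mulNr.
  rewrite subr_eq0 (IH k); [by move/eqP|lia|lia].
by move=> k lekn; rewrite -LX //; apply: eq_bigr => j _; rewrite hornerXn.
Qed.

(** * Linear forms and derivatives of multivariate polynomials *)

Lemma multinom_splitU (d D : nat) (m : 'X_{1..d}) : mdeg m = D.+1 ->
  exists i m', m = (U_(i) + m')%MM /\ mdeg m' = D.
Proof.
move=> degm; have [i mi] : exists i, (0 < m i)%N.
  apply/existsP; apply: contra_eqT degm; rewrite negb_exists => /forallP m0.
  by rewrite mdegE big1 // => i _; apply/eqP; rewrite -leqn0 leqNgt m0.
have eqm : m = (U_(i) + (m - U_(i)))%MM.
  by rewrite addmC submK //; apply/mnm_lepP => j; rewrite mnm1E; case: eqP => // <-.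
exists i, (m - U_(i))%MM; split=> //.
by move: degm; rewrite {1}eqm mdegD mdeg1 add1n => -[].
Qed.

Section LinearForms.
Context {R : comNzRingType} {d : nat}.
Implicit Types (x : 'I_d -> R) (p : {mpoly R[d]}).

Definition dotf x y : R := \sum_i x i * y i.

Definition linform x : {mpoly R[d]} := \sum_i x i *: 'X_i.

Definition sqnorm : {mpoly R[d]} := \sum_i 'X_i ^+ 2.

Lemma meval_linform x y : (linform x).@[y] = dotf x y.
Proof. by rewrite raddf_sum /=; apply: eq_bigr => i _; rewrite mevalZ mevalXU. Qed.

Lemma meval_sqnorm x : sqnorm.@[x] = \sum_i x i ^+ 2.
Proof. by rewrite raddf_sum /=; apply: eq_bigr => i _; rewrite rmorphXn /= mevalXU. Qed.

Lemma dhomogU i : ('X_i : {mpoly R[d]}) \is 1.-homog.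
Proof. by rewrite dhomogX /= mdeg1. Qed.

Lemma linform_homog x : linform x \is 1.-homog.
Proof. by apply: rpred_sum => i _; rewrite rpredZ // dhomogU. Qed.

Lemma sqnorm_homog : sqnorm \is 2.-homog.
Proof. by apply: rpred_sum => i _; apply: (dhomogMn 2 (dhomogU i)). Qed.

Lemma dhomog_msize_le p D : p \is D.-homog -> (msize p <= D.+1)%N.
Proof.
move=> /dhomogP hp; rewrite msizeE big_seq; apply/bigmax_leqP_seq => m sm _.
by rewrite hp.
Qed.

Lemma mderivU i j : ('X_j : {mpoly R[d]})^`M(i) = (i == j)%:R.
Proof.
rewrite mderivX mnm1E eq_sym; case: eqP => [->|_]; last by rewrite scale0r.
have -> : (U_(j) - U_(j) = 0 :> 'X_{1..d})%MM.
  by apply/mnmP => k; rewrite mnmBE mnm0E subnn.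
by rewrite mpolyX0 scale1r.
Qed.

Lemma mderiv_linform i x : (linform x)^`M(i) = (x i)%:MP.
Proof.
rewrite raddf_sum (bigD1 i) //= big1 => [|j neji]; rewrite mderivZ mderivU.
  by rewrite eqxx addr0 -mul_mpolyC mulr1.
by rewrite eq_sym (negPf neji) scaler0.
Qed.

Lemma mderiv_exp i p k : (p ^+ k)^`M(i) = k%:R *: (p ^+ k.-1 * p^`M(i)).
Proof.
elim: k => [|k IH]; first by rewrite expr0 -mpolyC1 mderivC scale0r.
rewrite exprS mderivM IH -scalerAr mulrA -exprS.
case: k {IH} => [|k]; first by rewrite scale0r addr0 scale1r mulrC.
by rewrite prednK // [_^`M(i) * _]mulrC -[X in X + _]scale1r -scalerDl -mulrS.
Qed.

Lemma mpoly_euler p D : p \is D.-homog -> \sum_i 'X_i * p^`M(i) = D%:R *: p.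
Proof.
move=> /dhomogP hp; rewrite [p]mpolyE scaler_sumr.
under eq_bigr do rewrite raddf_sum mulr_sumr.
rewrite exchange_big /= !big_seq; apply: eq_bigr => m sm.
transitivity (\sum_i p@_m *: ((m i)%:R *: 'X_[m] : {mpoly R[d]})).
  apply: eq_bigr => i _; rewrite mderivZ mderivX -!scalerAr; congr (_ *: _).
  case: (posnP (m i)) => [->|mi]; first by rewrite !scale0r.
  congr (_ *: _); rewrite -mpolyXD addmC submK //; apply/mnm_lepP => j.
  by rewrite mnm1E; case: eqP => // <-.
rewrite -scaler_sumr -scaler_suml -natr_sum -mdegE; have /= -> := hp _ sm.
by rewrite !scalerA mulrC.
Qed.

(** The chain rule.  Both sides are compatible with products and agree on the
    variables, hence on monomials. *)
Lemma mderiv_comp (T : d.-tuple {mpoly R[d]}) i p :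
  (p \mPo T)^`M(i) = \sum_j (p^`M(j) \mPo T) * (tnth T j)^`M(i).
Proof.
pose chain q := (q \mPo T)^`M(i) = \sum_j (q^`M(j) \mPo T) * (tnth T j)^`M(i).
have chainM q1 q2 : chain q1 -> chain q2 -> chain (q1 * q2).
  rewrite /chain rmorphM mderivM => -> ->.
  rewrite mulr_suml mulr_sumr -big_split; apply: eq_bigr => j _.
  by rewrite mderivM rmorphD !rmorphM /= mulrDl mulrAC mulrA.
have chainX m : chain 'X_[m].
  move: {2}(mdeg m) (erefl (mdeg m)) => D; elim: D m => [|D IH] m.
    move/eqP; rewrite mdeg_eq0 => /eqP ->; rewrite /chain mpolyX0 rmorph1.
    rewrite -mpolyC1 mderivC big1 // => j _.
    by rewrite mderivC comp_mpoly0 mul0r.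
  move/multinom_splitU => [k [m' [-> /IH chm']]]; rewrite mpolyXD.
  apply: chainM => //; rewrite /chain comp_mpolyXU (bigD1 k) //= big1.
    by rewrite mderivU eqxx rmorph1 mul1r addr0 -tnth_nth.
  by move=> j nejk; rewrite mderivU (negPf nejk) comp_mpoly0 mul0r.
rewrite [p]mpolyE (raddf_sum (comp_mpoly T)) /= (raddf_sum (mderiv i)) /=.
transitivity (\sum_(m <- msupp p) \sum_j p@_m *: ('X_[m]^`M(j) \mPo T) * (tnth T j)^`M(i)).
  apply: eq_bigr => m _; rewrite comp_mpolyZ mderivZ chainX scaler_sumr.
  by apply: eq_bigr => j _; rewrite scalerAl.
rewrite exchange_big; apply: eq_bigr => j _.
rewrite (raddf_sum (mderiv j)) /= (raddf_sum (comp_mpoly T)) mulr_suml;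
  apply: eq_bigr => m _ /=.
by rewrite mderivZ comp_mpolyZ.
Qed.

Lemma comp_linform_homog (r : 'I_d -> 'I_d -> R) (m : 'X_{1..d}) :
  ('X_[m] \mPo [tuple linform (r i) | i < d]) \is (mdeg m).-homog.
Proof.
move: {2}(mdeg m) (erefl (mdeg m)) => D; elim: D m => [|D IH] m.
  move/eqP; rewrite mdeg_eq0 => /eqP ->.
  by rewrite mpolyX0 rmorph1 mdeg0 dhomog1.
move/multinom_splitU => [i [m' [-> /IH hm']]].
rewrite mpolyXD rmorphM /= mdegD mdeg1; apply: dhomogM => //.
by rewrite comp_mpolyXU -tnth_nth tnth_mktuple linform_homog.
Qed.

End LinearForms.

(** * Gaussian cubature *)

(** Exactness for the standard Gaussian measure of R ^ d in degree at most K. *)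
Definition gauss_cubature (R : comNzRingType) (d K : nat) (I : finType) (W : I -> R)
    (y : I -> 'I_d -> R) : Prop :=
  forall m : 'X_{1..d}, (mdeg m <= K)%N ->
    expect W y (fun x => ('X_[m] : {mpoly R[d]}).@[x]) = \prod_j gauss_moment R (m j).

(** The d-th power of a one-dimensional quadrature. *)
Lemma gauss_cubature_exists (R : rcfType) (d K : nat) :
  exists (I : finType) (W : I -> R) (y : I -> 'I_d -> R),
    (forall i, 0 <= W i) /\ gauss_cubature K W y.
Proof.
have [w [lam [w0 wP]]] := gauss_hermite_quadrature R K.
exists {ffun 'I_d -> 'I_K.+1}, (fun f : {ffun _} => \prod_j w (f j)),
  (fun (f : {ffun _}) j => lam (f j)).
split=> [f|m lemK]; first by rewrite prodr_ge0.
transitivity (\prod_(j < d) \sum_(k < K.+1) w k * lam k ^+ m j).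
  rewrite bigA_distr_bigA; apply: eq_bigr => f _.
  by rewrite mevalX -big_split.
apply: eq_bigr => j _; rewrite wP // (leq_trans _ lemK) //.
by rewrite mdegE (bigD1 j) //= leq_addr.
Qed.

Lemma gauss_momentS (R : nzRingType) k :
  gauss_moment R k.+1 = k%:R * gauss_moment R k.-1.
Proof. by case: k => [|k] //=; rewrite mul0r. Qed.


Section GaussCubature.
Context {R : comNzRingType} {d K : nat} {I : finType} (W : I -> R) (y : I -> 'I_d -> R).
Hypothesis cubWy : gauss_cubature K W y.

Local Notation E p := (expect W y (fun x => p.@[x])).

Lemma expect_mpolyD p q : E (p + q) = E p + E q.
Proof. by rewrite -expectD; apply: eq_expect => x; rewrite mevalD. Qed.

Lemma expect_mpolyZ c p : E (c *: p) = c * E p.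
Proof. by rewrite -expectZ; apply: eq_expect => x; rewrite mevalZ. Qed.

Lemma expect_mpoly0 : E 0 = 0.
Proof. by rewrite -[0 in LHS](scale0r 0) expect_mpolyZ mul0r. Qed.

Lemma expect_mpoly_sum (J : Type) (r : seq J) (F : J -> {mpoly R[d]}) :
  E (\sum_(j <- r) F j) = \sum_(j <- r) E (F j).
Proof. by rewrite -expect_sum; apply: eq_expect => x; rewrite raddf_sum. Qed.

Lemma expect1 : E 1 = 1.
Proof.
rewrite -mpolyX0 cubWy ?mdeg0 // big1 // => j _.
by rewrite mnm0E.
Qed.

(** Stein's identity, the Gaussian integration by parts: on monomials it is the
    recurrence of the one-dimensional moments. *)
Lemma gauss_stein i (p : {mpoly R[d]}) : (msize p <= K)%N ->
  E ('X_i * p) = E (p^`M(i)).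
Proof.
move=> sp.
have mono m : (mdeg m < K)%N -> E ('X_i * 'X_[m]) = E ('X_[m]^`M(i)).
  move=> ltmK; rewrite -mpolyXD cubWy; last by rewrite mdegD mdeg1.
  rewrite (bigD1 i) //= mnmDE mnm1E eqxx add1n gauss_momentS.
  rewrite mderivX expect_mpolyZ cubWy; last first.
    by rewrite (leq_trans (mdegB _ _)) // ltnW.
  rewrite [in RHS](bigD1 i) //= mnmBE mnm1E eqxx subn1 mulrA; congr (_ * _).
  apply: eq_bigr => j neji; rewrite mnmDE mnmBE mnm1E eq_sym (negPf neji).
  by rewrite add0n subn0.
rewrite [p]mpolyE mulr_sumr raddf_sum /= !expect_mpoly_sum.
rewrite !big_seq; apply: eq_bigr => m sm.
rewrite -scalerAr mderivZ !expect_mpolyZ mono //.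
by rewrite (leq_trans _ sp) // msize_mdeg_lt.
Qed.

Lemma gauss_stein_linform x (p : {mpoly R[d]}) : (msize p <= K)%N ->
  E (linform x * p) = \sum_i x i * E (p^`M(i)).
Proof.
move=> sp; rewrite mulr_suml expect_mpoly_sum; apply: eq_bigr => i _.
by rewrite -scalerAl expect_mpolyZ gauss_stein.
Qed.

(** Stein's identity applied to each ['X_i * p], then Euler's identity. *)
Lemma gauss_radial (p : {mpoly R[d]}) D : p \is D.-homog -> (D.+2 <= K)%N ->
  E (sqnorm * p) = (d + D)%:R * E p.
Proof.
move=> hp leK; rewrite mulr_suml expect_mpoly_sum.
transitivity (\sum_(i < d) (E p + E ('X_i * p^`M(i)))).
  apply: eq_bigr => i _; rewrite expr2 -mulrA gauss_stein; last first.
    by rewrite (leq_trans _ leK) // dhomog_msize_le // -add1n dhomogM // dhomogU.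
  by rewrite mderivM mderivU eqxx mul1r expect_mpolyD.
rewrite big_split /= sumr_const card_ord -expect_mpoly_sum (mpoly_euler hp).
by rewrite expect_mpolyZ natrD mulrDl [d%:R * _]mulr_natl.
Qed.

Lemma gauss_radial_exp (p : {mpoly R[d]}) D k : p \is D.-homog -> (D + k.*2 <= K)%N ->
  E (sqnorm ^+ k * p) = (\prod_(j < k) (d + D + j.*2)%:R) * E p.
Proof.
move=> hp; elim: k => [|k IH] leK; first by rewrite big_ord0 !mul1r.
have hk : sqnorm ^+ k * p \is (D + k.*2).-homog.
  rewrite addnC; apply: dhomogM => //; rewrite -mul2n.
  exact: dhomogMn sqnorm_homog.
rewrite exprS -mulrA (gauss_radial hk) ?IH; last 2 first.
- by lia.
- by lia.
by rewrite big_ord_recr /= addnA mulrA [X in X * _]mulrC.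
Qed.

Lemma gauss_linform_exp x k : \sum_i x i ^+ 2 = 1 -> (k <= K)%N ->
  E (linform x ^+ k) = gauss_moment R k.
Proof.
move=> nx; elim: k {-2}k (leqnn k) => [|n IH] [|k] // lekn lekK.
- by rewrite expr0 expect1.
- by rewrite expr0 expect1.
rewrite exprS gauss_stein_linform; last first.
  by rewrite (leq_trans _ lekK) // dhomog_msize_le // -[k in k.-homog]mul1n dhomogMn //
    linform_homog.
rewrite gauss_momentS -(IH k.-1); [|lia..].
under eq_bigr => i _.
  rewrite mderiv_exp mderiv_linform [_ * (x i)%:MP]mulrC mul_mpolyC !expect_mpolyZ.
  rewrite mulrCA [x i * (x i * _)]mulrA -expr2; over.
by rewrite -mulr_sumr -mulr_suml nx mul1r.
Qed.

(** Composition with a rotation preserves Stein's identity, by the chain rule and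
    the orthogonality relations, and this identity determines the means of
    monomials by induction on the degree. *)
Lemma gauss_rotation_invariant (r : 'I_d -> 'I_d -> R) (p : {mpoly R[d]}) :
  (forall i j, dotf (r i) (r j) = (i == j)%:R) -> (msize p <= K.+1)%N ->
  E (p \mPo [tuple linform (r i) | i < d]) = E p.
Proof.
move=> orth; set T := [tuple _ | _ < _].
have mono n m : (mdeg m <= n)%N -> (mdeg m <= K)%N -> E ('X_[m] \mPo T) = E 'X_[m].
  elim: n m => [|n IH] m.
    rewrite leqn0 mdeg_eq0 => /eqP -> _.
    by rewrite mpolyX0 rmorph1.
  case Dm: (mdeg m) => [|D]; first by move=> _ _; apply: IH; rewrite Dm.
  have [i [m' [-> Dm']]] := multinom_splitU Dm => leDn leDK.
  rewrite mpolyXD rmorphM /= comp_mpolyXU -tnth_nth tnth_mktuple.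
  rewrite gauss_stein_linform; last first.
    by rewrite (leq_trans (dhomog_msize_le (comp_linform_homog _ _))) // Dm'.
  rewrite gauss_stein ?msizeX ?Dm' //.
  under eq_bigr do rewrite mderiv_comp expect_mpoly_sum mulr_sumr.
  rewrite exchange_big (bigD1 i) //= [X in _ + X]big1 ?addr0.
    under eq_bigr do rewrite tnth_mktuple mderiv_linform mulrC [_ * _%:MP]mulrC
      mul_mpolyC expect_mpolyZ mulrAC.
    rewrite -mulr_suml -/(dotf _ _) orth eqxx mul1r mderivX comp_mpolyZ !expect_mpolyZ IH //.
      by rewrite (leq_trans (mdegB _ _)) // Dm'.
    by rewrite (leq_trans (mdegB _ _)) // Dm' ltnW.
  move=> j neji.
  under eq_bigr do rewrite tnth_mktuple mderiv_linform mulrC [_ * _%:MP]mulrC mul_mpolyC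
    expect_mpolyZ mulrAC.
  by rewrite -mulr_suml -/(dotf _ _) orth (negPf neji) mul0r.
move=> sp; rewrite [p]mpolyE raddf_sum !expect_mpoly_sum !big_seq.
apply: eq_bigr => m sm /=; rewrite comp_mpolyZ !expect_mpolyZ (mono (mdeg m)) //.
by rewrite -ltnS (leq_trans _ sp) // msize_mdeg_lt.
Qed.

(** Integrating a form against a power of <x, y> gives a form in x of the same
    degree, for x on the sphere.  Pulling out a variable by Stein's identity,
    E[<x, y> ^ a y_i q] = a x_i E[<x, y> ^ (a - 1) q] + E[<x, y> ^ a d_i q], lowers
    the degree; the second term loses two degrees, restored by the factor
    |x| ^ 2 = 1. *)
Lemma gauss_zonal_expect (p : {mpoly R[d]}) D a : p \is D.-homog -> (a + D <= K)%N ->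
  exists2 g : {mpoly R[d]}, g \is D.-homog &
    forall x, \sum_i x i ^+ 2 = 1 -> E (linform x ^+ a * p) = g.@[x].
Proof.
have mono n D' a' (m : 'X_{1..d}) : (D' <= n)%N -> mdeg m = D' -> (a' + D' <= K)%N ->
    exists2 g : {mpoly R[d]}, g \is D'.-homog &
    forall x, \sum_i x i ^+ 2 = 1 -> E (linform x ^+ a' * 'X_[m]) = g.@[x].
  elim: n D' a' m => [|n IH] [|D'] a' m // leDn.
  - move=> /eqP; rewrite mdeg_eq0 addn0 => /eqP -> leK.
    exists (gauss_moment R a')%:MP => [|x nx];
      first by rewrite -[_%:MP]mulr1 mul_mpolyC rpredZ // dhomog1.
    by rewrite mpolyX0 mulr1 mevalC gauss_linform_exp.
  - move=> /eqP; rewrite mdeg_eq0 addn0 => /eqP -> leK.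
    exists (gauss_moment R a')%:MP => [|x nx];
      first by rewrite -[_%:MP]mulr1 mul_mpolyC rpredZ // dhomog1.
    by rewrite mpolyX0 mulr1 mevalC gauss_linform_exp.
  move=> /multinom_splitU[i [m' [-> Dm']]] leK.
  have [g1 hg1 g1P] : exists2 g : {mpoly R[d]}, g \is D'.-homog &
    forall x, \sum_i x i ^+ 2 = 1 -> E (linform x ^+ a'.-1 * 'X_[m']) = g.@[x].
    by apply: IH => //; lia.
  have [g2 hg2 g2P] : exists2 g : {mpoly R[d]}, g \is D'.+1.-homog &
    forall x, \sum_i x i ^+ 2 = 1 ->
      E (linform x ^+ a' * 'X_[m']^`M(i)) = g.@[x].
    rewrite mderivX; have [m0|mi] := posnP (m' i).
      exists 0 => [|x _]; first exact: rpred0.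
      by rewrite m0 scale0r mulr0 expect_mpoly0 meval0.
    have D1 : mdeg (m' - U_(i)) = D'.-1.
      have eqm : m' = (U_(i) + (m' - U_(i)))%MM.
        by rewrite addmC submK //; apply/mnm_lepP => j; rewrite mnm1E; case: eqP => // <-.
      by rewrite -Dm' [in RHS]eqm mdegD mdeg1.
    have D'_gt0 : (0 < D')%N by rewrite -Dm' mdegE (bigD1 i) //= addn_gt0 mi.
    have [||g hg gP] := IH D'.-1 a' (m' - U_(i))%MM _ D1; try lia.
    exists ((m' i)%:R *: (sqnorm * g)) => [|x nx].
      rewrite rpredZ //; have -> : D'.+1 = (2 + D'.-1)%N by lia.
      exact: dhomogM sqnorm_homog hg.
    by rewrite -scalerAr expect_mpolyZ gP // mevalZ mevalM meval_sqnorm nx mul1r.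
  exists (a'%:R *: ('X_i * g1) + g2) => [|x nx].
    by rewrite rpredD // rpredZ // -add1n dhomogM // dhomogU.
  rewrite mpolyXD mulrCA gauss_stein; last first.
    rewrite (leq_trans _ leK) // addnS dhomog_msize_le //.
    rewrite -[a' in (a' + _)%N]mul1n; apply: dhomogM; last by rewrite dhomogX /= Dm'.
    exact: (dhomogMn a' (linform_homog x)).
  rewrite mderivM expect_mpolyD g2P // mderiv_exp mderiv_linform mevalD; congr (_ + _).
  rewrite mevalZ mevalM mevalXU -g1P // -!expect_mpolyZ; apply: eq_expect => z.
  by rewrite !(mevalM, mevalZ, mevalC); ring.
move=> /dhomogP hp leK; rewrite [p]mpolyE.
have : {subset msupp p <= msupp p} by [].
elim: {1 3}(msupp p) => [|m ms IH] sub.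
  exists 0 => [|x _]; first exact: rpred0.
  by rewrite big_nil mulr0 expect_mpoly0 meval0.
have [|g hg gP] := IH; first by move=> m' sm'; apply: sub; rewrite inE sm' orbT.
have degm : mdeg m = D by apply: hp; apply: sub; rewrite inE eqxx.
have [g' hg' g'P] := mono D D a m (leqnn D) degm leK.
exists (p@_m *: g' + g) => [|x nx]; first by rewrite rpredD // rpredZ.
rewrite big_cons mulrDr expect_mpolyD gP // mevalD -scalerAr expect_mpolyZ g'P //.
by rewrite mevalZ.
Qed.

End GaussCubature.

(** * Finite measures on the sphere *)

Lemma meval_homog_scale (R : comNzRingType) (d D : nat) (p : {mpoly R[d]}) c (x : 'I_d -> R) :
  p \is D.-homog -> p.@[fun i => c * x i] = c ^+ D * p.@[x].
Proof.
move=> /dhomogP hp; rewrite !mevalE mulr_sumr !big_seq; apply: eq_bigr => m sm.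
rewrite mulrCA; congr (_ * _).
under eq_bigr do rewrite exprMn.
by rewrite big_split /= prodrXr -mdegE; have /= -> := hp m sm.
Qed.

(** The reflection that fixes the line of x, for x on the unit sphere. *)
Definition reflect_line (R : comNzRingType) (d : nat) (x z : 'I_d -> R) : 'I_d -> R :=
  fun i => 2 * dotf x z * x i - z i.

Lemma dotf_reflect (R : comNzRingType) (d : nat) (x z : 'I_d -> R) :
  \sum_i x i ^+ 2 = 1 -> dotf x (reflect_line x z) = dotf x z.
Proof.
move=> nx; rewrite {1}/dotf /reflect_line.
under eq_bigr do rewrite mulrBr mulrCA -expr2.
by rewrite sumrB -mulr_sumr nx mulr1 -/(dotf x z) mulr2n mulrDl mul1r addrK.
Qed.

Lemma sphere_reflect (R : realType) (d : nat) (x z : 'I_d -> R) :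
  sphere x -> sphere z -> sphere (reflect_line x z).
Proof.
move=> Sx Sz; rewrite /sphere /= /reflect_line; set t := dotf x z.
transitivity (\sum_i (4 * t ^+ 2 * x i ^+ 2 - 4 * t * (x i * z i) + z i ^+ 2)).
  by apply: eq_bigr => i _; ring.
by rewrite big_split sumrB /= -!mulr_sumr -/(dotf x z) -/t Sx Sz; ring.
Qed.

(** The mean of <x, y> ^ (2 k) over y uniform on the sphere, |x| = 1. *)
Definition zonal_moment (R : unitRingType) (d k : nat) : R :=
  \prod_(j < k) (j.*2.+1%:R / (d + j.*2)%:R).

(** A finite positive measure on the sphere that behaves like the uniform one on
    forms of even degree up to 2 m: invariance under reflections, the zonal
    moments, and the fact that zonal convolution preserves the forms of a given
    degree. *)
Definition sphere_design (R : realType) (d m : nat) (I : finType) (W : I -> R)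
    (u : I -> 'I_d -> R) : Prop :=
  [/\ forall i, 0 <= W i,
      forall i, sphere (u i),
      forall (p : {mpoly R[d]}) k x, p \is k.*2.-homog -> (k <= m)%N -> sphere x ->
        expect W u (fun z => p.@[reflect_line x z]) = expect W u (fun z => p.@[z]),
      forall k x, (k <= m)%N -> sphere x ->
        expect W u (fun z => dotf x z ^+ k.*2) = zonal_moment R d k &
      forall (p : {mpoly R[d]}) n a, p \is n.*2.-homog -> (a + n <= m)%N ->
        exists2 g : {mpoly R[d]}, g \is n.*2.-homog &
        forall x, sphere x -> expect W u (fun z => dotf x z ^+ a.*2 * p.@[z]) = g.@[x]].

(** Project the nodes of a Gaussian cubature to the sphere, giving y the weight
    |y| ^ (2 m) to make up for homogeneity.  By the radial formula, the mean of a
    form of degree 2 k becomes its Gaussian mean divided by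
    d (d + 2) ... (d + 2 k - 2), so that the three properties are inherited from
    the Gaussian cubature. *)
Lemma sphere_design_exists (R : realType) (d m : nat) : (0 < d)%N ->
  exists (I : finType) (W : I -> R) (u : I -> 'I_d -> R), sphere_design m W u.
Proof.
move=> d_gt0.
have [I [W [y [W0 cub]]]] := gauss_cubature_exists R d m.*2.+2.
pose r i := Num.sqrt (\sum_j y i j ^+ 2).
pose Z k : R := \prod_(j < k) (d + j.*2)%:R.
have Z_gt0 k : 0 < Z k.
  by apply: prodr_gt0 => j _; rewrite ltr0n addn_gt0 d_gt0.
(* Any point of the sphere will do for a node at the origin: y = r u holds with r = 0. *)
pose u i : 'I_d -> R :=
  if r i == 0 then fun j => (j == Ordinal d_gt0)%:R else fun j => (r i)^-1 * y i j.
have r2 i : r i ^+ 2 = \sum_j y i j ^+ 2.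
  by rewrite sqr_sqrtr // sumr_ge0 // => j _; rewrite sqr_ge0.
have yE i : y i = fun j => r i * u i j.
  apply: funext => j; rewrite /u; case: eqP => [r0|/eqP r0];
    last by rewrite mulrA divff ?mul1r.
  have /eqP := r2 i; rewrite r0 expr0n mul0r /= eq_sym psumr_eq0.
    by move=> /allP/(_ j (mem_index_enum _)) /=; rewrite sqrf_eq0 => /eqP.
  by move=> k _; rewrite sqr_ge0.
have Su i : sphere (u i).
  rewrite /sphere /= /u; case: eqP => [_|/eqP r0].
    rewrite (bigD1 (Ordinal d_gt0)) //= ?eqxx expr1n big1 ?addr0 // => j /negPf ->.
    by rewrite expr0n.
  under eq_bigr do rewrite exprMn.
  by rewrite -mulr_sumr -r2 -exprMn mulVf ?expr1n.
pose V i := W i * r i ^+ m.*2 / Z m.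
have key (p : {mpoly R[d]}) k : p \is k.*2.-homog -> (k <= m)%N ->
    expect V u (fun z => p.@[z]) = expect W y (fun z => p.@[z]) / Z k.
  move=> hp lekm.
  have Zm : Z m = Z k * \prod_(j < m - k) (d + k.*2 + j.*2)%:R.
    rewrite /Z -(subnKC lekm) big_split_ord /= addKn; congr (_ * _).
    by apply: eq_bigr => j _; rewrite /= doubleD addnA.
  have := @gauss_radial_exp _ _ _ _ _ _ cub p k.*2 (m - k) hp.
  rewrite -doubleD subnKC // => /(_ (leqW (leqnSn _))) Ep.
  apply: (mulIf (lt0r_neq0 (Z_gt0 k))); rewrite divfK ?lt0r_neq0 //.
  apply: (mulIf (x := \prod_(j < m - k) (d + k.*2 + j.*2)%:R)).
    have := lt0r_neq0 (Z_gt0 m); rewrite Zm mulf_eq0 negb_or => /andP[_].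
    by apply.
  rewrite -mulrA -Zm mulrC [RHS]mulrC -Ep -expectZ; apply: eq_bigr => i _.
  rewrite /V -!mulrA mulKf ?lt0r_neq0 //; congr (_ * _).
  rewrite mevalM rmorphXn /= meval_sqnorm -r2 [in RHS]yE (meval_homog_scale _ _ hp).
  rewrite mulrA -!exprM -exprD; congr (_ ^+ _ * _).
  by lia.
exists I, V, u; split=> //.
- move=> i; apply: divr_ge0; last exact: ltW.
  by rewrite mulr_ge0 // exprn_ge0 // sqrtr_ge0.
- move=> p k x hp lekm Sx.
  pose rr i j : R := 2 * x i * x j - (i == j)%:R.
  have rrE i z : dotf (rr i) z = reflect_line x z i.
    rewrite /dotf /rr /reflect_line; under eq_bigr do rewrite mulrBl.
    rewrite sumrB; congr (_ - _).
      by rewrite /dotf mulr_sumr mulr_suml; apply: eq_bigr => j _; ring.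
    rewrite (bigD1 i) //= eqxx mul1r big1 ?addr0 // => j neji.
    by rewrite eq_sym (negPf neji) mul0r.
  have orth i j : dotf (rr i) (rr j) = (i == j)%:R.
    rewrite rrE /reflect_line; have -> : dotf x (rr j) = x j.
      rewrite /dotf /rr; under eq_bigr do rewrite mulrBr mulrCA -expr2.
      rewrite sumrB -mulr_sumr Sx (bigD1 j) //= eqxx big1 ?addr0 => [|l nelj].
        by rewrite !mulr1 mulr2n mulrDl mul1r addrK.
      by rewrite eq_sym (negPf nelj) mulr0.
    by rewrite /rr eq_sym; ring.
  pose T := [tuple linform (rr i) | i < d].
  have pT z : p.@[reflect_line x z] = (p \mPo T).@[z].
    rewrite comp_mpoly_meval; apply: meval_eq => i.
    by rewrite tnth_mktuple meval_linform rrE.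
  rewrite (eq_expect _ _ pT) !(key _ k) //; last first.
    rewrite [p]mpolyE (raddf_sum (comp_mpoly T)) big_seq rpred_sum //= => mm sm.
    rewrite comp_mpolyZ rpredZ //; move/dhomogP/(_ mm sm): hp => /= <-.
    exact: comp_linform_homog.
  congr (_ / _); apply: (gauss_rotation_invariant cub orth).
  by rewrite (leq_trans (dhomog_msize_le hp)) //; lia.
- move=> k x lekm Sx.
  have hl : linform x ^+ k.*2 \is k.*2.-homog.
    by rewrite -[X in X.-homog]mul1n dhomogMn // linform_homog.
  rewrite (eq_expect _ _ (g := fun z => (linform x ^+ k.*2).@[z])); last first.
    by move=> z; rewrite rmorphXn /= meval_linform.
  rewrite (key _ k) // (gauss_linform_exp cub) //; last by lia.
  rewrite /zonal_moment big_split /= prodfV; congr (_ / _).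
  elim: k {lekm hl} => [|k IH]; first by rewrite big_ord0.
  by rewrite big_ord_recr doubleS /= -IH mulrC.
- move=> p n a hp leanm.
  have [|g hg gP] := gauss_zonal_expect cub (a := a.*2) hp; first by lia.
  exists ((Z (a + n)%N)^-1 *: g) => [|x Sx]; first by rewrite rpredZ.
  rewrite (eq_expect _ _ (g := fun z => (linform x ^+ a.*2 * p).@[z])); last first.
    by move=> z; rewrite mevalM rmorphXn /= meval_linform.
  have hl : linform x ^+ a.*2 * p \is (a + n).*2.-homog.
    rewrite doubleD dhomogM //; have := dhomogMn a.*2 (linform_homog x).
    by rewrite mul1n.
  by rewrite (key _ _ hl) // gP // mevalZ mulrC.
Qed.

(** * Gegenbauer polynomials and a concentrated polynomial *)

Section Zonal.
Context {R : rcfType} (d : nat).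
Implicit Types p q f : {poly R}.

(** The mean of t ^ k for t = <x, y>, with x fixed and y uniform on the sphere. *)
Definition zonal_mean_pow k : R := if odd k then 0 else zonal_moment R d k./2.

Definition zonal_mean p : R := \sum_(k < size p) p`_k * zonal_mean_pow k.

Local Notation S := zonal_mean.

Lemma zonal_meanE n p : (size p <= n)%N -> S p = \sum_(k < n) p`_k * zonal_mean_pow k.
Proof.
move=> sp; rewrite /S (big_ord_widen n (fun k => p`_k * zonal_mean_pow k) sp).
rewrite big_mkcond; apply: eq_bigr => k _; case: ltnP => // le_p_k.
by rewrite nth_default ?mul0r.
Qed.

Lemma zonal_mean_is_linear : scalar S.
Proof.
move=> c p q; pose n := maxn (size p) (size q).
have sp : (size p <= n)%N by rewrite leq_maxl.
have sq : (size q <= n)%N by rewrite leq_maxr.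
rewrite (zonal_meanE sp) (zonal_meanE sq) (@zonal_meanE n); last first.
  rewrite (leq_trans (size_polyD _ _)) // geq_max sq andbT.
  by rewrite (leq_trans (size_scale_leq _ _)).
rewrite mulr_sumr -big_split; apply: eq_bigr => k _.
by rewrite coefD coefZ mulrDl mulrA.
Qed.

HB.instance Definition _ :=
  GRing.isLinear.Build R {poly R} R *%R S zonal_mean_is_linear.

Lemma zonal_meanD p q : S (p + q) = S p + S q. Proof. exact: raddfD. Qed.
Lemma zonal_meanB p q : S (p - q) = S p - S q. Proof. exact: raddfB. Qed.
Lemma zonal_meanZ c p : S (c *: p) = c * S p. Proof. exact: linearZ. Qed.
Lemma zonal_meanZl c p q : S (c *: p * q) = c * S (p * q).
Proof. by rewrite -scalerAl zonal_meanZ. Qed.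
Lemma zonal_mean_sum (J : Type) (r : seq J) (F : J -> {poly R}) :
  S (\sum_(j <- r) F j) = \sum_(j <- r) S (F j).
Proof. exact: raddf_sum. Qed.

Lemma zonal_meanXn k : S 'X^k = zonal_mean_pow k.
Proof.
rewrite (@zonal_meanE k.+1) ?size_polyXn // big_ord_recr /= coefXn eqxx mul1r.
rewrite big1 ?add0r // => i _; rewrite coefXn.
by rewrite ltn_eqF ?mul0r // ltn_ord.
Qed.

Hypothesis d_ge2 : (1 < d)%N.

(** Integration by parts against the density of t on [-1, 1], which is
    proportional to (1 - t ^ 2) ^ ((d - 3) / 2). *)
Lemma zonal_mean_by_parts f : S ((1 - 'X^2) * f^`()) = (d%:R - 1) * S ('X * f).
Proof.
have mono k : S ((1 - 'X^2) * ('X^k)^`()) = (d%:R - 1) * S ('X * 'X^k).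
  rewrite derivXn -exprS zonal_meanXn mulrnAr linearMn /= mulrBl mul1r linearB /=.
  case: k => [|k]; first by rewrite mulr0n /zonal_mean_pow /= mulr0.
  rewrite /= -exprD add2n !zonal_meanXn /zonal_mean_pow /= negbK.
  case: (boolP (odd k)) => [_|ek]; first by rewrite subrr mul0rn mulr0.
  rewrite /zonal_moment big_ord_recr /=; set z := \prod_(i < _) _.
  have -> : k./2.*2 = k by have := odd_double_half k; rewrite (negPf ek) add0n.
  have dk : (d + k)%:R != 0 :> R by rewrite pnatr_eq0; lia.
  rewrite -mulr_natr; move: dk; rewrite natrD -[k.+1]addn1 natrD => dk.
  by field.
have -> : f = \sum_(k < size f) f`_k *: 'X^k by rewrite -poly_def coefK.
rewrite [(\sum_(_ < _) _)^`()]raddf_sum /= ['X * _]mulr_sumr.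
rewrite mulr_sumr !zonal_mean_sum mulr_sumr; apply: eq_bigr => k _.
by rewrite derivZ -!scalerAr !zonal_meanZ mono mulrCA.
Qed.

(** The Gegenbauer polynomials of parameter (d - 2) / 2, scaled to be 1 at t = 1;
    this scaling still makes sense for d = 2. *)
Fixpoint gegenbauer_fix (k : nat) : {poly R} :=
  match k with
  | 0 => 1
  | 1 => 'X
  | (k'.+1 as k1).+1 => (k' + d.-1)%:R^-1 *:
       ((k'.*2 + d)%:R *: ('X * gegenbauer_fix k1) - k'.+1%:R *: gegenbauer_fix k')
  end.

(* Locked, since unification unfolds the recursion in [c *: _] patterns. *)
Definition gegenbauer : nat -> {poly R} := locked gegenbauer_fix.

Local Notation G := gegenbauer.

Lemma gegenbauer0 : G 0 = 1. Proof. by rewrite /gegenbauer -lock. Qed.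
Lemma gegenbauer1 : G 1 = 'X. Proof. by rewrite /gegenbauer -lock. Qed.
Lemma gegenbauerSS k : G k.+2 = (k + d.-1)%:R^-1 *:
  ((k.*2 + d)%:R *: ('X * G k.+1) - k.+1%:R *: G k).
Proof. by rewrite /gegenbauer -lock. Qed.

Lemma gegenbauer_rec k : (k + d.-1)%:R *: G k.+2 =
  (k.*2 + d)%:R *: ('X * G k.+1) - k.+1%:R *: G k.
Proof.
rewrite gegenbauerSS scalerA divff ?scale1r //.
by rewrite pnatr_eq0; lia.
Qed.

Lemma gegenbauer_mulX k : 'X * G k.+1 =
  ((k + d.-1)%:R / (k.*2 + d)%:R) *: G k.+2 + (k.+1%:R / (k.*2 + d)%:R) *: G k.
Proof.
have kd : (k.*2 + d)%:R != 0 :> R by rewrite pnatr_eq0; lia.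
have cancel a : (k.*2 + d)%:R * (a / (k.*2 + d)%:R) = a :> R by rewrite mulrC divfK.
apply: (scalerI kd); rewrite scalerDr !scalerA !cancel.
by rewrite gegenbauer_rec subrK.
Qed.

Lemma size_gegenbauer k : (size (G k) <= k.+1)%N.
Proof.
elim: k {-2}k (leqnn k) => [|n IH] [|[|k]] // lekn;
  rewrite ?gegenbauer0 ?gegenbauer1 ?size_poly1 ?size_polyX //.
rewrite gegenbauerSS (leq_trans (size_scale_leq _ _)) //.
rewrite (leq_trans (size_polyD _ _)) // geq_max size_polyN.
have sk : (size (G k) <= k.+1)%N by apply: IH; lia.
have sk1 := IH k.+1 lekn; apply/andP; split.
  apply: leq_trans (size_scale_leq _ _) _; apply: leq_trans (size_polyMleq _ _) _.
  by rewrite size_polyX.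
by apply: leq_trans (size_scale_leq _ _) _; apply: leq_trans sk _; lia.
Qed.

Lemma gegenbauer_parity k i : odd (i + k) -> (G k)`_i = 0.
Proof.
elim: k {-2}k (leqnn k) i => [|n IH] [|[|k]] // lekn i oik.
- by rewrite gegenbauer0 coef1; case: i oik.
- by rewrite gegenbauer0 coef1; case: i oik.
- by rewrite gegenbauer1 coefX; case: i oik => [|[|]].
rewrite gegenbauerSS !(coefZ, coefB, coefXM) (IH k) ?mulr0 ?subr0; last 2 first.
- lia.
- by move: oik; rewrite !addnS /= negbK.
case: i oik => [|i] oik; first by rewrite !mulr0.
by rewrite /= (IH k.+1) ?mulr0 //; move: oik; rewrite !addnS !addSn /= !negbK.
Qed.

(** Modulo the recurrence, the second relation at k is the first one at k + 1;
    differentiating the recurrence then gives the induction step from both. *)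
Lemma deriv_gegenbauer k :
  (1 - 'X^2) * (G k)^`() = (k%:R + d%:R - 2) *: ('X * G k - G k.+1) /\
  (1 - 'X^2) * (G k.+1)^`() = k.+1%:R *: (G k - 'X * G k.+1).
Proof.
have dE : d.-1%:R = d%:R - 1 :> R by rewrite -subn1 natrB // ltnW.
have first k' : (1 - 'X^2) * (G k'.+1)^`() = k'.+1%:R *: (G k' - 'X * G k'.+1) ->
    (1 - 'X^2) * (G k'.+1)^`() = (k'.+1%:R + d%:R - 2) *: ('X * G k'.+1 - G k'.+2).
  move=> ->; have -> : k'.+1%:R + d%:R - 2 = (k' + d.-1)%:R :> R.
    by rewrite natrD dE -addn1 natrD; ring.
  rewrite [RHS]scalerBr gegenbauer_rec opprB addrCA -scalerBl scalerBr; congr (_ + _).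
  rewrite -scaleNr; congr (_ *: _).
  by rewrite !natrD dE -addn1 natrD -mul2n natrM; ring.
elim: k => [|k [IH1 IH2]].
  rewrite gegenbauer0 gegenbauer1; split.
    by rewrite derivC mulr0 mulr1 subrr scaler0.
  by rewrite derivX mulr1 scale1r expr2.
split; first exact: first.
have kd : (k + d.-1)%:R != 0 :> {poly R}.
  by rewrite -polyC_natr polyC_eq0 pnatr_eq0; lia.
have := gegenbauer_rec k; have := congr1 (@deriv R) (gegenbauer_rec k).
rewrite derivB !derivZ derivM derivX mul1r -!mul_polyC !polyC_natr.
move: IH1 IH2; rewrite -!mul_polyC !rmorphB rmorphD /= !polyC_natr => IH1 IH2 drec rec.
apply: (mulfI kd); rewrite mulrCA drec mulrBr.
have -> : (k + d.-1)%:R * (k.+2%:R * (G k.+1 - 'X * G k.+2)) =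
  (k + d.-1)%:R * k.+2%:R * G k.+1 - k.+2%:R * 'X * ((k + d.-1)%:R * G k.+2).
  by ring.
rewrite rec.
have -> : (1 - 'X^2) * ((k.*2 + d)%:R * (G k.+1 + 'X * (G k.+1)^`())) -
    (1 - 'X^2) * (k.+1%:R * (G k)^`()) =
  (k.*2 + d)%:R * (1 - 'X^2) * G k.+1 + (k.*2 + d)%:R * 'X * ((1 - 'X^2) * (G k.+1)^`())
  - k.+1%:R * ((1 - 'X^2) * (G k)^`()) by ring.
have dEp : d.-1%:R = d%:R - 1 :> {poly R} by rewrite -subn1 natrB // ltnW.
rewrite IH1 IH2 !natrD dEp -addnn -[k.+2]addn2 -[k.+1]addn1 !natrD.
ring.
Qed.

(** Integration by parts applied to the structure relation expresses
    S ('X * G k.+1) by S (G k); the recurrence then makes S (G k.+2) a multiple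
    of k * S (G k), hence zero for all k by induction. *)
Lemma zonal_mean_gegenbauer k : S (G k.+1) = 0.
Proof.
have step k' : (k' + d.-1)%:R * S (G k'.+2) = k'%:R * k'.+1%:R / (k' + d)%:R * S (G k').
  have kd : (k' + d)%:R != 0 :> R by rewrite pnatr_eq0; lia.
  have dE : d.-1%:R = d%:R - 1 :> R by rewrite -subn1 natrB // ltnW.
  have := zonal_mean_by_parts (G k'.+1).
  rewrite (deriv_gegenbauer k').2 zonal_meanZ zonal_meanB => byparts.
  have SX : S ('X * G k'.+1) = k'.+1%:R / (k' + d)%:R * S (G k').
    apply: (mulfI kd); rewrite mulrA [_ * (_ / _)]mulrC divfK //.
    have -> : (k' + d)%:R = k'.+1%:R + (d%:R - 1) :> R.
      by rewrite natrD -[k'.+1]addn1 natrD; ring.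
    by rewrite mulrDl -byparts mulrBr addrC subrK.
  rewrite -zonal_meanZ gegenbauer_rec zonal_meanB !zonal_meanZ SX.
  move: kd; rewrite -addnn -[k'.+1]addn1 !natrD => kd; field.
  exact: kd.
elim: k {-2}k (leqnn k) => [|n IH] [|[|k]] // lekn.
- by rewrite gegenbauer1 -['X]expr1 zonal_meanXn.
- by rewrite gegenbauer1 -['X]expr1 zonal_meanXn.
- have kd : (0 + d.-1)%:R != 0 :> R by rewrite pnatr_eq0; lia.
  by apply: (mulfI kd); rewrite step !mul0r mulr0.
have kd : (k.+1 + d.-1)%:R != 0 :> R by rewrite pnatr_eq0; lia.
by apply: (mulfI kd); rewrite step IH ?mulr0 //; lia.
Qed.

(** The three-term recurrence moves the factor ['X] from one index to the other,
    so that everything reduces to the vanishing of the means. *)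
Lemma gegenbauer_orthogonal i j : (i < j)%N -> S (G i * G j) = 0.
Proof.
elim: i {-2}i (leqnn i) j => [|n IH] [|i] // lein [|j] // ltij.
- by rewrite gegenbauer0 mul1r zonal_mean_gegenbauer.
- by rewrite gegenbauer0 mul1r zonal_mean_gegenbauer.
case: i lein ltij => [|i] lein ltij.
  case: j ltij => [|j] // _.
  rewrite gegenbauer1 gegenbauer_mulX zonal_meanD !zonal_meanZ.
  by rewrite !zonal_mean_gegenbauer !mulr0 addr0.
have kd : (i + d.-1)%:R != 0 :> R by rewrite pnatr_eq0; lia.
apply: (mulfI kd); rewrite mulr0 -zonal_meanZ scalerAl gegenbauer_rec mulrBl zonal_meanB.
rewrite !zonal_meanZl [S (G i * _)]IH ?mulr0 ?subr0; [|lia..].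
rewrite ['X * _ * _]mulrAC gegenbauer_mulX.
rewrite mulrDl zonal_meanD !zonal_meanZl.
rewrite ![_ * G i.+1]mulrC !IH ?mulr0 ?addr0 ?mulr0 //; lia.
Qed.

Definition gegenbauer_norm k : R := S (G k * G k).
Local Notation N := gegenbauer_norm.

Lemma gegenbauer_norm1 : N 1 = d%:R^-1.
Proof.
rewrite /N gegenbauer1 -expr2 zonal_meanXn /zonal_mean_pow /= /zonal_moment.
by rewrite big_ord1 addn0 mul1r.
Qed.

Lemma gegenbauer_normS k :
  N k.+2 = (k.*2 + d)%:R * k.+2%:R / ((k + d.-1)%:R * (k.+1.*2 + d)%:R) * N k.+1.
Proof.
have kd : (k + d.-1)%:R != 0 :> R by rewrite pnatr_eq0; lia.
have kd2 : (k.+1.*2 + d)%:R != 0 :> R by rewrite pnatr_eq0; lia.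
apply: (mulfI kd); rewrite /N -zonal_meanZ scalerAl gegenbauer_rec mulrBl zonal_meanB.
rewrite !zonal_meanZl (@gegenbauer_orthogonal k k.+2) // mulr0 subr0.
rewrite ['X * _ * _]mulrAC gegenbauer_mulX mulrDl zonal_meanD !zonal_meanZl.
rewrite [G k.+3 * _]mulrC (@gegenbauer_orthogonal k.+1 k.+3) // mulr0 add0r.
move: kd kd2; move: ((k + d.-1)%:R : R) ((k.+1.*2 + d)%:R : R) ((k.*2 + d)%:R : R)
  (k.+2%:R : R) => a b c e a0 b0.
by field; rewrite a0 b0.
Qed.

Lemma gegenbauer_norm_gt0 k : 0 < N k.+1.
Proof.
elim: k => [|k IH]; first by rewrite gegenbauer_norm1 invr_gt0 ltr0n; lia.
rewrite gegenbauer_normS mulr_gt0 // divr_gt0 // -natrM ltr0n; lia.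
Qed.

Definition normalized_gegenbauer k : {poly R} := (Num.sqrt (N k))^-1 *: G k.
Local Notation P := normalized_gegenbauer.

Lemma normalized_gegenbauer_orthonormal i j : S (P i.+1 * P j.+1) = (i == j)%:R.
Proof.
rewrite /P zonal_meanZl -scalerAr zonal_meanZ.
have [ltij|ltji|<-] := ltngtP i j.
- by rewrite gegenbauer_orthogonal ?mulr0.
- by rewrite [G _ * _]mulrC gegenbauer_orthogonal ?mulr0.
rewrite -/(N _) mulrA -expr2 exprVn sqr_sqrtr ?mulVf //.
  by rewrite gt_eqF ?gegenbauer_norm_gt0.
by rewrite ltW ?gegenbauer_norm_gt0.
Qed.

Lemma normalized_gegenbauer_sum_sqr n (g : nat -> nat) (x : nat -> R) : injective g ->
  S ((\sum_(j < n) x j *: P (g j).+1) ^+ 2) = \sum_(j < n) x j ^+ 2.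
Proof.
move=> inj_g; rewrite expr2 mulr_suml zonal_mean_sum; apply: eq_bigr => i _.
rewrite mulr_sumr zonal_mean_sum (bigD1 i) //= big1 ?addr0 => [|j neji];
  rewrite zonal_meanZl -scalerAr zonal_meanZ normalized_gegenbauer_orthonormal.
  by rewrite eqxx mulr1 expr2.
by rewrite (inj_eq inj_g) eq_sym val_eqE (negPf neji) !mulr0.
Qed.

(** The off-diagonal entries of the Jacobi matrix of the zonal measure, indexed
    so that entry k links the degrees k + 1 and k + 2. *)
Definition jacobi_coef k : R :=
  (k + d.-1)%:R / (k.*2 + d)%:R * (Num.sqrt (N k.+2) / Num.sqrt (N k.+1)).

Lemma sqrt_gegenbauer_norm k : 0 < Num.sqrt (N k.+1) /\ Num.sqrt (N k.+1) ^+ 2 = N k.+1.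
Proof.
by have N_gt0 := gegenbauer_norm_gt0 k; rewrite sqrtr_gt0 sqr_sqrtr ?ltW.
Qed.

Lemma normalized_gegenbauer_mulX k : 'X * P k.+2 = jacobi_coef k.+1 *: P k.+3 +
  jacobi_coef k *: P k.+1.
Proof.
have [r1_gt0 r1E] := sqrt_gegenbauer_norm k.
have [r2_gt0 r2E] := sqrt_gegenbauer_norm k.+1.
have [r3_gt0 r3E] := sqrt_gegenbauer_norm k.+2.
rewrite /P -scalerAr gegenbauer_mulX scalerDr !scalerA; congr (_ *: _ + _ *: _).
  rewrite /jacobi_coef; move: (lt0r_neq0 r2_gt0) (lt0r_neq0 r3_gt0).
  move: (Num.sqrt (N k.+2)) (Num.sqrt (N k.+3)) (_ / _) => t s a t0 s0.
  by field; rewrite t0 s0.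
have E : Num.sqrt (N k.+2) ^+ 2 = (k.*2 + d)%:R * k.+2%:R /
    ((k + d.-1)%:R * (k.+1.*2 + d)%:R) * Num.sqrt (N k.+1) ^+ 2.
  by rewrite r1E r2E gegenbauer_normS.
have kd : (k + d.-1)%:R != 0 :> R by rewrite pnatr_eq0; lia.
have kd1 : (k.*2 + d)%:R != 0 :> R by rewrite pnatr_eq0; lia.
have kd2 : (k.+1.*2 + d)%:R != 0 :> R by rewrite pnatr_eq0; lia.
rewrite /jacobi_coef; move: E kd kd1 kd2.
move: ((k + d.-1)%:R : R) ((k.+1.*2 + d)%:R : R) ((k.*2 + d)%:R : R) (k.+2%:R : R) => a b
  c e E a0 c0 b0.
have r1 : Num.sqrt (N k.+1) != 0 by rewrite gt_eqF.
have r2 : Num.sqrt (N k.+2) != 0 by rewrite gt_eqF.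
move: (Num.sqrt (N k.+1)) (Num.sqrt (N k.+2)) r1 r2 E => s t s0 t0 E.
have -> : a / c * (t / s) / s = (a / c / (t * s ^+ 2)) * t ^+ 2 by field; rewrite s0 t0 c0.
by rewrite E; field; rewrite a0 b0 c0 t0 s0.
Qed.

(** Here 4 (jacobi_coef k) ^ 2 = 1 - (d - 2) (d - 4) / ((2 k + d) (2 k + d + 2)),
    and 1 - delta >= (1 - delta) ^ 2. *)
Lemma jacobi_coef_ge k delta : 0 <= delta <= 1 ->
  d%:R ^+ 2 <= 4 * k%:R ^+ 2 * delta -> (1 - delta) / 2 <= jacobi_coef k.
Proof.
move=> /andP[de0 de1] hd.
have [r1_gt0 r1E] := sqrt_gegenbauer_norm k.
have [r2_gt0 r2E] := sqrt_gegenbauer_norm k.+1.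
have kd : 0 < (k + d.-1)%:R :> R by rewrite ltr0n; lia.
have kd1 : 0 < (k.*2 + d)%:R :> R by rewrite ltr0n; lia.
have kd2 : 0 < (k.+1.*2 + d)%:R :> R by rewrite ltr0n; lia.
have jac_ge0 : 0 <= jacobi_coef k by rewrite /jacobi_coef mulr_ge0 // divr_ge0 // ltW.
have jac2 : jacobi_coef k ^+ 2 = (k + d.-1)%:R * k.+2%:R / ((k.*2 + d)%:R * (k.+1.*2 + d)%:R).
  rewrite /jacobi_coef !exprMn !exprVn r1E r2E gegenbauer_normS.
  have := gegenbauer_norm_gt0 k; move: kd kd1 kd2.
  move: ((k + d.-1)%:R : R) ((k.+1.*2 + d)%:R : R) ((k.*2 + d)%:R : R) (k.+2%:R : R) (N
    k.+1) => a b c e n a0 c0 b0 n0.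
  by field; rewrite !gt_eqF.
rewrite -(ler_pXn2r (ltn0Sn 1)) ?nnegrE ?divr_ge0 ?subr_ge0 // jac2.
rewrite ler_pdivlMr ?mulr_gt0 //.
have dE : d.-1%:R = d%:R - 1 :> R by rewrite -subn1 natrB // ltnW.
rewrite !natrD dE -!addnn !natrD -[k.+2]addn2 -[k.+1]addn1 !natrD.
have k0 : 0 <= k%:R :> R by [].
have d2 : 2 <= d%:R :> R by rewrite ler_nat.
move: (k%:R) (d%:R) k0 d2 hd => kk dd k0 d2 hd.
have h1 : 0 <= (1 - delta) * delta by rewrite mulr_ge0 // subr_ge0.
have h2 : 0 <= (kk + kk + dd) * (kk + 1 + (kk + 1) + dd) by rewrite mulr_ge0; lra.
have h3 : dd ^+ 2 <= (kk + kk + dd) * (kk + 1 + (kk + 1) + dd) * delta.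
  apply: le_trans hd _; rewrite ler_wpM2r //; nra.
have := mulr_ge0 h1 h2; nra.
Qed.

Lemma sum_adjacent_sqr (c : nat -> R) J : c 0%N = 0 -> c J = 0 ->
  \sum_(j < J) (c j + c j.+1) ^+ 2 =
  4 * \sum_(j < J.+1) c j ^+ 2 - \sum_(j < J) (c j.+1 - c j) ^+ 2.
Proof.
move=> c0 cJ.
have s1 : \sum_(j < J.+1) c j ^+ 2 = \sum_(j < J) c j ^+ 2.
  by rewrite big_ord_recr /= cJ expr0n addr0.
have s2 : \sum_(j < J.+1) c j ^+ 2 = \sum_(j < J) c j.+1 ^+ 2.
  by rewrite big_ord_recl /= c0 expr0n add0r.
have -> : 4 * \sum_(j < J.+1) c j ^+ 2 =
  \sum_(j < J) (2 * c j ^+ 2 + 2 * c j.+1 ^+ 2).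
  by rewrite big_split /= -!mulr_sumr -s1 -s2; ring.
by rewrite -sumrB; apply: eq_bigr => i _; ring.
Qed.

(** Indices k such that the degree k + 1 runs through 2 J, 2 J + 2, ..., 4 J: of
    one parity, and large enough for the Jacobi coefficients to be close to 1/2. *)
Definition window J j := (J.*2.-1 + j.*2)%N.

Definition window_poly J (c : nat -> R) : {poly R} :=
  \sum_(j < J.+1) c j *: P (window J j).+1.

Lemma window_inj J : injective (window J).
Proof. by move=> i j; rewrite /window; lia. Qed.

Lemma window_lt J j : (0 < J)%N -> (j <= J)%N -> (window J j < 4 * J)%N.
Proof. by rewrite /window; lia. Qed.

Lemma odd_window J j : (0 < J)%N -> odd (window J j).
Proof. by rewrite /window; lia. Qed.

Lemma window_poly_sqr J c :
  S (window_poly J c ^+ 2) = \sum_(j < J.+1) c j ^+ 2.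
Proof. exact/normalized_gegenbauer_sum_sqr/window_inj. Qed.

(** As c vanishes at both ends, the two families of odd-degree terms produced
    by the three-term recurrence pair up exactly. *)
Lemma window_poly_mulX J c : (0 < J)%N -> c 0%N = 0 -> c J = 0 ->
  'X * window_poly J c = \sum_(j < J)
    (jacobi_coef (window J j) * c j + jacobi_coef (window J j).+1 * c j.+1)
      *: P (window J j).+2.
Proof.
move=> J_gt0 c0 cJ; set f := window J.
have f_gt0 j : (0 < f j)%N by rewrite /f /window; lia.
have XP j : 'X * P (f j).+1 =
    jacobi_coef (f j) *: P (f j).+2 + jacobi_coef (f j).-1 *: P (f j).
  by case: (f j) (f_gt0 j) => // k _; rewrite normalized_gegenbauer_mulX.
rewrite mulr_sumr.
transitivity (\sum_(j < J.+1) (jacobi_coef (f j) * c j) *: P (f j).+2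
   + \sum_(j < J.+1) (jacobi_coef (f j).-1 * c j) *: P (f j)).
  rewrite -big_split; apply: eq_bigr => j _ /=.
  by rewrite -scalerAr XP scalerDr !scalerA ![c j * _]mulrC.
rewrite big_ord_recr [X in _ + X]big_ord_recl /= c0 cJ !mulr0 !scale0r.
rewrite addr0 add0r -big_split; apply: eq_bigr => j _ /=.
have -> : f (bump 0 j) = (f j).+2 by rewrite /f /window /bump; lia.
by rewrite -scalerDl.
Qed.

Lemma window_poly_second_moment_ge J c a : (0 < J)%N -> c 0%N = 0 -> c J = 0 ->
  (forall j, (j <= J)%N -> 0 <= c j) -> 0 <= a ->
  (forall k, (J <= k)%N -> a <= jacobi_coef k) ->
  a ^+ 2 * \sum_(j < J) (c j + c j.+1) ^+ 2 <= S ('X^2 * window_poly J c ^+ 2).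
Proof.
move=> J_gt0 c0 cJ c_ge0 a_ge0 a_le.
have le_window j : (J <= window J j)%N by rewrite /window; lia.
rewrite -exprMn window_poly_mulX //.
rewrite (normalized_gegenbauer_sum_sqr _ (g := fun j => (window J j).+1)
  (fun j => jacobi_coef (window J j) * c j + jacobi_coef (window J j).+1 * c j.+1));
  last by move=> i j [] /window_inj.
rewrite mulr_sumr; apply: ler_sum => j _.
have c1 : 0 <= c j by rewrite c_ge0 // ltnW.
have c2 : 0 <= c j.+1 by rewrite c_ge0.
have a1 : a <= jacobi_coef (window J j) by apply: a_le.
have a2 : a <= jacobi_coef (window J j).+1 by apply: a_le; apply: leqW.
have j1_ge0 := le_trans a_ge0 a1; have j2_ge0 := le_trans a_ge0 a2.
rewrite -exprMn mulrDr ler_pXn2r // ?nnegrE; last 2 first.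
- by apply: addr_ge0; apply: mulr_ge0.
- by apply: addr_ge0; apply: mulr_ge0.
by rewrite lerD // ler_wpM2r.
Qed.

(** A profile that vanishes at both ends of the window and whose energy is
    O(J ^ -2) times its square norm. *)
Lemma parabola_sums (J : nat) : let c j : R := j%:R * (J%:R - j%:R) in
  \sum_(j < J.+1) c j ^+ 2 = J%:R * (J%:R ^+ 4 - 1) / 30 /\
  \sum_(j < J) (c j.+1 - c j) ^+ 2 = J%:R * (J%:R ^+ 2 - 1) / 3.
Proof.
move=> c.
have sum2 n : \sum_(j < n) c j ^+ 2 =
    J%:R ^+ 2 * (n%:R - 1) * n%:R * (2 * n%:R - 1) / 6
    - 2 * J%:R * (n%:R * (n%:R - 1) / 2) ^+ 2
    + (n%:R - 1) * n%:R * (2 * n%:R - 1) * (3 * n%:R ^+ 2 - 3 * n%:R - 1) / 30.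
  elim: n => [|n IH]; first by rewrite big_ord0; field.
  by rewrite big_ord_recr /= IH /c -[n.+1]addn1 natrD; field.
have sumd n : \sum_(j < n) (c j.+1 - c j) ^+ 2 =
    n%:R * (J%:R - 1) ^+ 2 - 2 * (J%:R - 1) * n%:R * (n%:R - 1)
    + 2 * (n%:R - 1) * n%:R * (2 * n%:R - 1) / 3.
  elim: n => [|n IH]; first by rewrite big_ord0; field.
  by rewrite big_ord_recr /= IH /c -[n.+1]addn1 natrD; field.
split; last by rewrite sumd; field.
by rewrite big_ord_recr /= sum2 /c; field.
Qed.

(** The two losses in the second moment of a window polynomial: [delta] bounds
    the defect of the recurrence coefficients, and 5 / (2 (J ^ 2 + 1)) is the
    quotient of the two sums over a parabola, divided by 4. *)
Lemma second_moment_defect_le (D J delta : R) : 2 <= D -> D <= J ->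
  delta = D ^+ 2 / (4 * J ^+ 2) ->
  1 - (1 - delta) ^+ 2 * (1 - 5 / (2 * (J ^+ 2 + 1))) <= 9 / 8 * (D / J) ^+ 2.
Proof.
move=> D2 DJ deltaE; have J0 : 0 < J by lra.
have JJ0 : 0 < J ^+ 2 by rewrite exprn_gt0.
have delta_ge0 : 0 <= delta by rewrite deltaE divr_ge0 ?sqr_ge0 // mulr_ge0 ?sqr_ge0.
have delta_le1 : delta <= 1.
  by rewrite deltaE ler_pdivrMr ?mul1r; [nra|rewrite mulr_gt0].
have -> : 9 / 8 * (D / J) ^+ 2 = 2 * delta + 5 / 8 * (D ^+ 2 / J ^+ 2).
  by rewrite deltaE; field; lra.
have le2 : 5 / (2 * (J ^+ 2 + 1)) <= 5 / 8 * (D ^+ 2 / J ^+ 2).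
  have w0 : 0 < (J ^+ 2)^-1 by rewrite invr_gt0.
  have w1 : (J ^+ 2)^-1 * J ^+ 2 = 1 by rewrite mulVf // gt_eqF.
  have DD4 : 4 <= D ^+ 2 by nra.
  rewrite ler_pdivrMr; last by lra.
  move: (D ^+ 2) (J ^+ 2) ((J ^+ 2)^-1) JJ0 w0 w1 DD4 => DD JJ w JJ0 w0 w1 DD4.
  have -> : 5 / 8 * (DD * w) * (2 * (JJ + 1)) = 5 / 4 * DD * (w * JJ + w) by field.
  by rewrite w1; nra.
have ge0 : 0 <= 5 / (2 * (J ^+ 2 + 1)) by rewrite divr_ge0 //; lra.
move: (5 / (2 * (J ^+ 2 + 1))) (5 / 8 * (D ^+ 2 / J ^+ 2)) le2 ge0 => v w vw v0.
have h : 0 <= v * (delta * (2 - delta)).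
  by apply: mulr_ge0 v0 (mulr_ge0 delta_ge0 _); lra.
have h2 := sqr_ge0 delta; nra.
Qed.

(** The polynomial behind the rate (d / l) ^ 2.  In the normalized Gegenbauer
    basis, multiplication by ['X] is a Jacobi matrix whose entries are 1/2 up to
    O((d / k) ^ 2), so that for coefficients varying slowly over a window of
    width l the quotient of S ('X^2 * q ^ 2) by S (q ^ 2) is 1 up to
    O((d / l) ^ 2): the mass of q ^ 2 sits where t ^ 2 is near 1. *)
Lemma concentrated_zonal_poly l : (8 * d <= l)%N ->
  exists q : {poly R}, [/\ (size q <= l.+1)%N, forall i, odd i -> q`_i = 0,
    0 < S (q ^+ 2) &
    S ((1 - 'X^2) * q ^+ 2) <= 72 * (d%:R / l%:R) ^+ 2 * S (q ^+ 2)].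
Proof.
(* The degrees in window J are at most 4 J. *)
move=> ledl; pose J := (l %/ 4)%N.
have leJl : (4 * J <= l)%N by rewrite mulnC leq_trunc_div.
have leJ8 : (l <= 8 * J)%N by rewrite /J; lia.
have J_ge : (d <= J)%N by lia.
have J_gt0 : (0 < J)%N by lia.
have l0 : 0 < l%:R :> R by rewrite ltr0n; lia.
have l8 : l%:R <= 8 * J%:R :> R by rewrite -natrM ler_nat.
have d2 : 2 <= d%:R :> R by rewrite ler_nat.
have dJ : d%:R <= J%:R :> R by rewrite ler_nat.
have J2 : 2 <= J%:R :> R by apply: le_trans dJ.
pose c j : R := j%:R * (J%:R - j%:R).
have c0 : c 0%N = 0 by rewrite /c mul0r.
have cJ : c J = 0 by rewrite /c subrr mulr0.
have c_ge0 j : (j <= J)%N -> 0 <= c j.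
  by move=> lej; rewrite mulr_ge0 // subr_ge0 ler_nat.
have [c2 cd] := parabola_sums J.
pose q := window_poly J c.
have qq : S (q ^+ 2) = J%:R * (J%:R ^+ 4 - 1) / 30 by rewrite window_poly_sqr.
have qq_gt0 : 0 < S (q ^+ 2).
  rewrite qq divr_gt0 // mulr_gt0 //; first by lra.
  by rewrite subr_gt0 exprn_egt1 //; lra.
pose delta : R := d%:R ^+ 2 / (4 * J%:R ^+ 2).
have delta01 : 0 <= delta <= 1.
  rewrite divr_ge0 ?mulr_ge0 ?sqr_ge0 //= ler_pdivrMr ?mul1r; last by nra.
  by nra.
have jac_ge k : (J <= k)%N -> (1 - delta) / 2 <= jacobi_coef k.
  move=> leJk; apply: jacobi_coef_ge => //.
  have : J%:R <= k%:R :> R by rewrite ler_nat.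
  rewrite /delta mulrA ler_pdivlMr; last by nra.
  move=> JK; rewrite mulrC ler_wpM2r ?sqr_ge0 // ler_wpM2l //.
  by rewrite ler_pXn2r ?nnegrE //; lra.
have a_ge0 : 0 <= (1 - delta) / 2 by move/andP: delta01 => [_ ?]; lra.
have Xq_ge := window_poly_second_moment_ge J_gt0 c0 cJ c_ge0 a_ge0 jac_ge.
exists q; split=> //.
- rewrite (leq_trans (size_sum _ _ _)) //; apply/bigmax_leqP => j _.
  rewrite (leq_trans (size_scale_leq _ _)) // (leq_trans (size_scale_leq _ _)) //.
  rewrite (leq_trans (size_gegenbauer _)) // !ltnS (leq_trans _ leJl) //.
  by rewrite window_lt // -ltnS.
- move=> i oi; rewrite coef_sum big1 // => j _.
  by rewrite !coefZ gegenbauer_parity ?mulr0 // oddD oi /= odd_window.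
rewrite mulrBl mul1r zonal_meanB.
have defect : (1 - (1 - delta) ^+ 2 * (1 - 5 / (2 * (J%:R ^+ 2 + 1)))) * S (q ^+ 2) <=
   72 * (d%:R / l%:R) ^+ 2 * S (q ^+ 2).
  apply: ler_wpM2r; first exact: ltW.
  apply: le_trans (second_moment_defect_le d2 dJ erefl) _.
  have J0 : 0 < J%:R :> R by lra.
  have hdl : d%:R / J%:R <= 8 * (d%:R / l%:R) :> R.
    have h : 1 <= 8 * J%:R / l%:R :> R by rewrite ler_pdivlMr ?mul1r.
    rewrite ler_pdivrMr //.
    have -> : 8 * (d%:R / l%:R) * J%:R = d%:R * (8 * J%:R / l%:R) :> R by ring.
    by rewrite ler_peMr.
  have : 0 <= d%:R / J%:R :> R by rewrite divr_ge0.
  move: (d%:R / J%:R) (d%:R / l%:R) hdl => x y; nra.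
apply: le_trans defect.
rewrite mulrBl mul1r lerD2l lerN2; apply: le_trans Xq_ge.
rewrite sum_adjacent_sqr // c2 cd qq le_eqVlt; apply/orP; left; apply/eqP; field.
by nra.
Qed.

End Zonal.

(** * Forms on great circles *)

(** The coefficients depend linearly on the values at N distinct nodes, here the
    1 / (j + 1); the constant is the entrywise norm of the inverse Vandermonde
    matrix. *)
Lemma coef_le_sup (R : realFieldType) (N : nat) :
  exists2 C : R, 0 <= C & forall (p : {poly R}) B, (size p <= N)%N ->
    (forall t, 0 <= t <= 1 -> `|p.[t]| <= B) -> \sum_(k < N) `|p`_k| <= C * B.
Proof.
pose a : 'rV[R]_N := \row_j (j.+1%:R)^-1.
pose V := Vandermonde N a.
have uV : V \in unitmx.
  rewrite unitmxE det_Vandermonde unitfE; apply/prodf_neq0 => i _.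
  apply/prodf_neq0 => j ltij; rewrite !mxE subr_eq0.
  by rewrite (inj_eq invr_inj) eqr_nat eqSS gtn_eqF.
exists (\sum_(k < N) \sum_j `|invmx V j k|).
  by apply: sumr_ge0 => k _; apply: sumr_ge0.
move=> p B sp pB; pose c : 'rV[R]_N := \row_k p`_k.
have cE : c = (\row_j p.[a 0 j]) *m invmx V.
  rewrite -[LHS](mulmxK uV); congr (_ *m _); apply/rowP => j.
  rewrite !mxE (horner_coef_wide _ sp); apply: eq_bigr => k _.
  by rewrite !mxE.
rewrite mulr_suml; apply: ler_sum => k _.
have -> : p`_k = c 0 k by rewrite mxE.
rewrite cE mxE (le_trans (ler_norm_sum _ _ _)) // mulr_suml.
apply: ler_sum => j _; rewrite !mxE normrM mulrC ler_wpM2l // pB //.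
by rewrite invr_ge0 ler0n /= invf_le1 ?ltr0n // ler1n.
Qed.

Lemma mpoly_on_line (R : comNzRingType) (d D : nat) (h : {mpoly R[d]}) (x z : 'I_d -> R) :
  h \is D.-homog -> exists2 H : {poly R}, (size H <= D.+1)%N &
    forall b, H.[b] = h.@[fun i => x i + b * z i].
Proof.
have mono E (m : 'X_{1..d}) : mdeg m = E -> exists2 H : {poly R}, (size H <= E.+1)%N &
    forall b, H.[b] = ('X_[m] : {mpoly R[d]}).@[fun i => x i + b * z i].
  elim: E m => [|E IH] m.
    move/eqP; rewrite mdeg_eq0 => /eqP ->; exists 1 => [|b]; first by rewrite size_poly1.
    by rewrite hornerC mpolyX0 meval1.
  move/multinom_splitU => [i [m' [-> /IH [H sH HE]]]].
  pose L : {poly R} := (x i)%:P + z i *: 'X.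
  exists (L * H) => [|b].
    apply: leq_trans (size_polyMleq _ _) _.
    have : (size L <= 2)%N.
      apply: leq_trans (size_polyD _ _) _; rewrite geq_max.
      rewrite (leq_trans (size_polyC_leq1 _)) //.
      by rewrite (leq_trans (size_scale_leq _ _)) // size_polyX.
    move: (size _) (size H) sH => s1 s2; lia.
  rewrite hornerM_comm; last by rewrite /comm_poly mulrC.
  by rewrite HE mpolyXD mevalM mevalXU hornerD hornerC hornerZ hornerX mulrC mulrC [z i *
    b]mulrC.
move=> /dhomogP hh; rewrite [h]mpolyE.
have : {subset msupp h <= msupp h} by [].
elim: {1 3}(msupp h) => [|m ms IH] sub.
  by exists 0 => [|b]; rewrite ?size_poly0 // big_nil horner0 meval0.
have [|H sH HE] := IH; first by move=> m' sm'; apply: sub; rewrite inE sm' orbT.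
have degm : mdeg m = D by apply: hh; apply: sub; rewrite inE eqxx.
have [H' sH' H'E] := mono D m degm.
exists (h@_m *: H' + H) => [|b].
  apply: leq_trans (size_polyD _ _) _; rewrite geq_max sH andbT.
  exact: leq_trans (size_scale_leq _ _) _.
by rewrite big_cons hornerD hornerZ H'E HE mevalD mevalZ.
Qed.

Lemma homog_le_norm (R : realType) (d n : nat) (h : {mpoly R[d]}) B :
  h \is n.*2.-homog -> (forall x, sphere x -> `|h.@[x]| <= B) ->
  forall y, 0 < \sum_i y i ^+ 2 -> `|h.@[y]| <= (\sum_i y i ^+ 2) ^+ n * B.
Proof.
move=> hh hB y; set s := \sum_i _ => s0; pose r := Num.sqrt s.
have r0 : 0 < r by rewrite sqrtr_gt0.
have r2 : r ^+ 2 = s by rewrite sqr_sqrtr // ltW.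
have -> : h.@[y] = r ^+ n.*2 * h.@[fun i => r^-1 * y i].
  rewrite -(meval_homog_scale _ _ hh); apply: meval_eq => i.
  by rewrite mulrA divff ?mul1r // gt_eqF.
have sn_ge0 : 0 <= s ^+ n by rewrite exprn_ge0 // ltW.
rewrite -mul2n exprM r2 normrM (ger0_norm sn_ge0).
rewrite ler_wpM2l // hB // /sphere /=.
under eq_bigr do rewrite exprMn.
by rewrite -mulr_sumr -/s -r2 -exprMn mulVf ?expr1n // gt_eqF.
Qed.

Lemma bernoulli_ineq (R : realDomainType) (n : nat) (w : R) :
  w <= 1 -> 1 - n%:R * w <= (1 - w) ^+ n.
Proof.
move=> w_le1; have w1 : 0 <= 1 - w by rewrite subr_ge0.
elim: n => [|k IH]; first by rewrite mul0r subr0 expr0.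
rewrite exprS -[k.+1]addn1 natrD.
have : 0 <= k%:R * (w * w) by rewrite mulr_ge0 // -expr2 sqr_ge0.
have := ler_wpM2l w1 IH; nra.
Qed.

(** Averaging over the sign of r kills the term of degree 1. *)
Lemma horner_even_part_bound (R : realFieldType) (N : nat) (H : {poly R}) r :
  (size H <= N)%N -> 0 <= r <= 1 ->
  `|(H.[r] + H.[- r]) / 2 - H.[0]| <= r ^+ 2 * \sum_(k < N) `|H`_k|.
Proof.
move=> sH /andP[r_ge0 r_le1].
rewrite !(horner_coef_wide _ sH) -big_split mulr_suml -sumrB /=.
apply: le_trans (ler_norm_sum _ _ _) _; rewrite mulr_sumr; apply: ler_sum => k _.
rewrite -mulrDr -mulrA -mulrBr normrM mulrC ler_wpM2r //.
case: (nat_of_ord k) => [|[|k']].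
- by rewrite !expr0 (_ : (1 + 1) / 2 - 1 = 0) ?normr0 ?sqr_ge0 //; field.
- by rewrite !expr1 subrr mul0r subr0 normr0 sqr_ge0.
rewrite [0 ^+ _]expr0n subr0 normrM [`|2^-1|]ger0_norm ?invr_ge0 //.
rewrite ler_pdivrMr // (le_trans (ler_normD _ _)) // !normrX normrN.
rewrite (ger0_norm r_ge0) -mulr2n -[leLHS]mulr_natr ler_wpM2r //.
by rewrite -addn2 exprD ler_piMl ?sqr_ge0 // exprn_ile1.
Qed.

Lemma sum_sqr_orth_part (R : comNzRingType) (d : nat) (x u : 'I_d -> R) :
  \sum_i x i ^+ 2 = 1 -> \sum_i u i ^+ 2 = 1 ->
  \sum_i (u i - dotf x u * x i) ^+ 2 = 1 - dotf x u ^+ 2.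
Proof.
move=> nx nu; set t := dotf x u.
transitivity (\sum_i (u i ^+ 2 - 2 * t * (x i * u i) + t ^+ 2 * x i ^+ 2)).
  by apply: eq_bigr => i _; ring.
by rewrite big_split sumrB /= -!mulr_sumr -/(dotf x u) nu nx -/t; ring.
Qed.

(** On the great circle through x and u, a form of even degree, averaged over
    the reflection fixing x, is x's value plus O(w) where w = 1 - <x, u> ^ 2 is the
    squared sine of the angle.  Up to the power of the cosine, the form is on the
    tangent line at x a polynomial in one variable, bounded on [0, 1], and only
    its even part survives.  The constant depends on n alone, which is where the
    independence of the dimension comes from.  When w >= 1/2 the
    triangle inequality suffices. *)
Lemma reflection_mean_bound (R : realType) (n : nat) :
  exists2 C : R, 0 <= C & forall (d : nat) (h : {mpoly R[d]}) B,
    h \is n.*2.-homog -> (forall x, sphere x -> `|h.@[x]| <= B) ->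
    forall x u, sphere x -> sphere u ->
    `|(h.@[u] + h.@[reflect_line x u]) / 2 - h.@[x]| <= C * B * (1 - dotf x u ^+ 2).
Proof.
have [C1 C1_ge0 C1P] := coef_le_sup R n.*2.+1.
exists (2 * C1 * 2 ^+ n + n%:R + 4) => [|d h B hh hB x u Sx Su].
  by rewrite !addr_ge0 // !mulr_ge0 // exprn_ge0.
have B_ge0 : 0 <= B by apply: le_trans (hB x Sx).
set t := dotf x u; set w := 1 - t ^+ 2.
have wE : \sum_i (u i - t * x i) ^+ 2 = w by apply: sum_sqr_orth_part.
have w_ge0 : 0 <= w by rewrite -wE sumr_ge0 // => i _; rewrite sqr_ge0.
have Sr : sphere (reflect_line x u) by apply: sphere_reflect.
have [w_big|w_small] := leP (1 / 2) w.
  have := hB x Sx; have := hB u Su; have := hB _ Sr.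
  rewrite !ler_norml => /andP[a1 a2] /andP[b1 b2] /andP[c1 c2].
  have : 0 <= (2 * C1 * 2 ^+ n + n%:R) * B * w.
    by rewrite !mulr_ge0 // addr_ge0 // !mulr_ge0 // exprn_ge0.
  have : 0 <= B * (w - 1 / 2) by rewrite mulr_ge0 // subr_ge0.
  by move=> p1 p2; apply/andP; split; nra.
have t2 : t ^+ 2 = 1 - w by rewrite /w; ring.
have t2_gt0 : 0 < t ^+ 2 by rewrite t2; lra.
have t0 : t != 0 by rewrite -sqrf_eq0 gt_eqF.
(* u is proportional to x + y with y tangent at x of squared length v. *)
pose v := w / t ^+ 2.
have v_ge0 : 0 <= v by rewrite divr_ge0 // ltW.
have v_le1 : v <= 1 by rewrite ler_pdivrMr // mul1r t2; lra.
have v_le : v <= 2 * w.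
  by rewrite ler_pdivrMr // t2; nra.
pose y i := u i / t - x i.
have yy : \sum_i y i ^+ 2 = v.
  rewrite /v -wE mulr_suml; apply: eq_bigr => i _; rewrite /y.
  by field.
have xy : \sum_i x i * y i = 0.
  under eq_bigr do rewrite mulrBr mulrA -expr2.
  by rewrite sumrB -mulr_suml -/(dotf x u) -/t divff // Sx subrr.
have uE i : u i = t * (x i + y i) by rewrite /y addrC subrK mulrC divfK.
have rE i : reflect_line x u i = t * (x i - y i).
  by rewrite /reflect_line -/t uE; ring.
have tn : t ^+ n.*2 = (1 - w) ^+ n by rewrite -mul2n exprM t2.
have [v0|v_neq0] := eqVneq v 0.
  have y0 i : y i = 0.
    move/eqP: yy; rewrite v0 psumr_eq0 => [/allP/(_ i (mem_index_enum _))|j _];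
      last exact: sqr_ge0.
    by rewrite /= sqrf_eq0 => /eqP.
  have w0 : w = 0 by apply/eqP; move/eqP: v0; rewrite mulf_eq0 invr_eq0 (gt_eqF t2_gt0) orbF.
  have -> : h.@[u] = h.@[x].
    rewrite (meval_eq (v2 := fun i => t * x i)) => [|i]; last by rewrite uE y0 addr0.
    by rewrite (meval_homog_scale _ _ hh) tn w0 subr0 expr1n mul1r.
  have -> : h.@[reflect_line x u] = h.@[x].
    rewrite (meval_eq (v2 := fun i => t * x i)) => [|i]; last by rewrite rE y0 subr0.
    by rewrite (meval_homog_scale _ _ hh) tn w0 subr0 expr1n mul1r.
  have -> : (h.@[x] + h.@[x]) / 2 - h.@[x] = 0 by field.
  by rewrite normr0 w0 mulr0.
pose r := Num.sqrt v.
have r2 : r ^+ 2 = v by rewrite sqr_sqrtr.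
have r_gt0 : 0 < r by rewrite sqrtr_gt0 lt_def v_neq0.
have r_le1 : r <= 1 by rewrite -[1]sqrtr1 ler_wsqrtr.
pose z i := r^-1 * y i.
have yE i : y i = r * z i by rewrite /z mulrA divff ?mul1r // gt_eqF.
have zz : \sum_i z i ^+ 2 = 1.
  by under eq_bigr do rewrite exprMn;
    rewrite -mulr_sumr yy -r2 -exprMn mulVf ?expr1n // gt_eqF.
have xz : \sum_i x i * z i = 0.
  by under eq_bigr do rewrite mulrCA; rewrite -mulr_sumr xy mulr0.
have [H sH HE] := mpoly_on_line x z hh.
have HB b : 0 <= b <= 1 -> `|H.[b]| <= 2 ^+ n * B.
  move=> /andP[b0 b1]; rewrite HE.
  have nb : \sum_i (x i + b * z i) ^+ 2 = 1 + b ^+ 2.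
    transitivity (\sum_i (x i ^+ 2 + 2 * b * (x i * z i) + b ^+ 2 * z i ^+ 2)).
      by apply: eq_bigr => i _; ring.
    by rewrite !big_split /= -!mulr_sumr Sx xz zz; ring.
  apply: le_trans (homog_le_norm hh hB _) _; rewrite nb; first by rewrite ltr_wpDr // sqr_ge0.
  rewrite ler_wpM2r // lerXn2r ?nnegrE //; first by rewrite addr_ge0 ?sqr_ge0.
  by rewrite -[leRHS]/(1 + 1) lerD2l expr_le1.
have := C1P H _ sH HB; set sumH := \sum_(k < _) _ => sumH_le.
have H0E : H.[0] = h.@[x] by rewrite HE; apply: meval_eq => i; rewrite mul0r addr0.
have huE : h.@[u] = (1 - w) ^+ n * H.[r].
  rewrite -tn HE -(meval_homog_scale _ _ hh); apply: meval_eq => i.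
  by rewrite uE yE.
have hrE : h.@[reflect_line x u] = (1 - w) ^+ n * H.[- r].
  rewrite -tn HE -(meval_homog_scale _ _ hh); apply: meval_eq => i.
  by rewrite rE yE mulNr.
have D0 : `|(H.[r] + H.[- r]) / 2 - H.[0]| <= v * sumH.
  by rewrite -r2; apply: horner_even_part_bound; rewrite // r_le1 ltW.
have bern : 1 - n%:R * w <= (1 - w) ^+ n by apply: bernoulli_ineq; lra.
have T1 : 0 <= (1 - w) ^+ n <= 1 by rewrite exprn_ge0 ?exprn_ile1 //; lra.
have H0B : `|H.[0]| <= B by rewrite H0E hB.
rewrite huE hrE -H0E.
set T := (1 - w) ^+ n in T1 bern *.
have -> : (T * H.[r] + T * H.[- r]) / 2 - H.[0] =
   T * ((H.[r] + H.[- r]) / 2 - H.[0]) - (1 - T) * H.[0] by field.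
apply: le_trans (ler_normB _ _) _; rewrite !normrM.
case/andP: T1 => T_ge0 T_le1.
rewrite (ger0_norm T_ge0) [`|1 - T|]ger0_norm ?subr_ge0 //.
have b1 : T * `|(H.[r] + H.[- r]) / 2 - H.[0]| <= 2 * w * (C1 * (2 ^+ n * B)).
  apply: le_trans (_ : v * sumH <= _).
    by apply: le_trans D0; rewrite ler_piMl.
  by rewrite ler_pM // /sumH sumr_ge0.
have b2 : (1 - T) * `|H.[0]| <= n%:R * w * B.
  by rewrite ler_pM ?subr_ge0 // lerBlDl -lerBlDr.
apply: le_trans (lerD b1 b2) _.
have : 0 <= 4 * B * w by rewrite !mulr_ge0.
by rewrite -subr_ge0 => p4; rewrite -subr_ge0 (_ : _ - _ = 4 * B * w - 0) //; ring.
Qed.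

(** * The approximate identity *)

(** A constant on the sphere, as a form of degree 2 n. *)
Lemma const_form_homog (R : comNzRingType) (d n : nat) (a : R) :
  (a *: sqnorm ^+ n : {mpoly R[d]}) \is n.*2.-homog.
Proof. by rewrite rpredZ // -mul2n; exact: dhomogMn sqnorm_homog. Qed.

Lemma meval_const_form (R : realType) (d n : nat) (a : R) (x : 'I_d -> R) :
  sphere x -> (a *: sqnorm ^+ n : {mpoly R[d]}).@[x] = a.
Proof. by move=> Sx; rewrite mevalZ rmorphXn /= meval_sqnorm Sx expr1n mulr1. Qed.

Section EvenPoly.
Context {R : rcfType}.

Lemma sum_double (V : nmodType) (n : nat) (f : nat -> V) :
  \sum_(i < n.*2) f i = \sum_(k < n) (f k.*2 + f k.*2.+1).
Proof.
elim: n => [|n IH]; first by rewrite !big_ord0.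
by rewrite doubleS !big_ord_recr /= IH addrA.
Qed.

Lemma even_horner (Q : {poly R}) L t : (forall i, odd i -> Q`_i = 0) ->
  (size Q <= L.*2.+1)%N -> Q.[t] = \sum_(k < L.+1) Q`_k.*2 * t ^+ k.*2.
Proof.
move=> Qodd sQ; rewrite (@horner_coef_wide _ L.+1.*2) ?(leq_trans sQ) ?doubleS //.
rewrite -doubleS (sum_double _ (fun i => Q`_i * t ^+ i)); apply: eq_bigr => k _.
by rewrite (Qodd k.*2.+1) ?mul0r ?addr0 //= odd_double.
Qed.

Lemma even_zonal_mean d (Q : {poly R}) L : (forall i, odd i -> Q`_i = 0) ->
  (size Q <= L.*2.+1)%N -> zonal_mean d Q = \sum_(k < L.+1) Q`_k.*2 * zonal_moment R d k.
Proof.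
move=> Qodd sQ; rewrite (@zonal_meanE _ _ L.+1.*2) ?(leq_trans sQ) ?doubleS //.
rewrite -doubleS (sum_double _ (fun i => Q`_i * zonal_mean_pow d i)); apply: eq_bigr => k _.
by rewrite (Qodd k.*2.+1) /= ?odd_double // mul0r addr0 /zonal_mean_pow odd_double doubleK.
Qed.

Lemma even_sqr (q : {poly R}) : (forall i, odd i -> q`_i = 0) ->
  forall i, odd i -> (q ^+ 2)`_i = 0.
Proof.
move=> qodd i oi; rewrite expr2 coefM big1 // => j _.
case oj: (odd j); first by rewrite qodd ?mul0r.
by rewrite (qodd (i - j)%N) ?mulr0 // oddB ?oi ?oj // -ltnS.
Qed.

End EvenPoly.

Section DesignKernel.
Context {R : realType} (d m : nat) (I : finType) (W : I -> R) (u : I -> 'I_d -> R).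
Hypothesis design : sphere_design m W u.
Variables (Q : {poly R}) (L : nat).
Hypothesis Q_even : forall i, odd i -> Q`_i = 0.
Hypothesis sizeQ : (size Q <= L.*2.+1)%N.

Lemma design_kernel_expand (f : ('I_d -> R) -> R) x :
  expect W u (fun z => Q.[dotf x z] * f z) =
  \sum_(k < L.+1) Q`_k.*2 * expect W u (fun z => dotf x z ^+ k.*2 * f z).
Proof.
under [RHS]eq_bigr do rewrite -expectZ.
rewrite -expect_sum; apply: eq_expect => z.
by rewrite (even_horner _ Q_even sizeQ) mulr_suml; apply: eq_bigr => k _; rewrite mulrA.
Qed.

Lemma design_kernel_mean x : (L <= m)%N -> sphere x ->
  expect W u (fun z => Q.[dotf x z]) = zonal_mean d Q.
Proof.
have [_ _ _ momP _] := design; move=> leLm Sx.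
rewrite (eq_expect _ _ (g := fun z => Q.[dotf x z] * 1)) => [|z]; last by rewrite mulr1.
rewrite design_kernel_expand (even_zonal_mean _ Q_even sizeQ).
apply: eq_bigr => k _; congr (_ * _).
rewrite -(momP k x) //; last by rewrite (leq_trans _ leLm) // -ltnS.
by apply: eq_expect => z; rewrite mulr1.
Qed.

Lemma design_kernel_homog (h : {mpoly R[d]}) n : h \is n.*2.-homog -> (L + n <= m)%N ->
  exists2 g : {mpoly R[d]}, g \is n.*2.-homog &
    forall x, sphere x -> expect W u (fun z => Q.[dotf x z] * h.@[z]) = g.@[x].
Proof.
have [_ _ _ _ projP] := design; move=> hh leLm.
have lekm (k : 'I_L.+1) : (k + n <= m)%N.
  by rewrite (leq_trans _ leLm) // leq_add2r -ltnS.
pose g k := s2val (cid2 (projP h n (nat_of_ord k) hh (lekm k))).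
exists (\sum_k Q`_(nat_of_ord k).*2 *: g k) => [|x Sx].
  by rewrite rpred_sum // => k _; rewrite rpredZ // /g; case: cid2.
rewrite design_kernel_expand raddf_sum; apply: eq_bigr => k _ /=.
by rewrite mevalZ /g; case: cid2 => /= gk _ ->.
Qed.

Lemma design_kernel_reflect (h : {mpoly R[d]}) n x : h \is n.*2.-homog ->
  (L + n <= m)%N -> sphere x ->
  expect W u (fun z => Q.[dotf x z] * h.@[reflect_line x z]) =
  expect W u (fun z => Q.[dotf x z] * h.@[z]).
Proof.
have [_ _ reflP _ _] := design; move=> hh leLm Sx.
rewrite !design_kernel_expand; apply: eq_bigr => k _; congr (_ * _).
have hk : linform x ^+ k.*2 * h \is (k + n).*2.-homog.
  rewrite doubleD dhomogM //; have := dhomogMn k.*2 (linform_homog x).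
  by rewrite mul1n.
have lekm : (k + n <= m)%N by rewrite (leq_trans _ leLm) // leq_add2r -ltnS.
have := reflP _ _ x hk lekm Sx.
rewrite (eq_expect _ _ (g := fun z => dotf x z ^+ k.*2 * h.@[reflect_line x z])) => [->|z].
  by apply: eq_expect => z; rewrite mevalM rmorphXn /= meval_linform.
by rewrite mevalM rmorphXn /= meval_linform dotf_reflect.
Qed.

End DesignKernel.

(** For fixed z, the kernel q(<x, z>) ^ 2 is a square in x. *)
Lemma kernel_sos (R : realType) (d l : nat) (I : finType) (W : I -> R) (u : I -> 'I_d -> R)
    (q : {poly R}) (f : ('I_d -> R) -> R) (g : {mpoly R[d]}) :
  (forall i, 0 <= W i) -> (forall i, 0 <= f (u i)) -> (size q <= l.+1)%N ->
  (forall x, sphere x -> g.@[x] = expect W u (fun z => q.[dotf x z] ^+ 2 * f z)) ->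
  sos_on_sphere l g.
Proof.
move=> W0 f0 sq gE.
pose v i : {mpoly R[d]} := Num.sqrt (W i * f (u i)) *: \sum_(k < l.+1) q`_k *: linform (u
  i) ^+ k.
exists [seq v i | i <- enum I] => [_ /mapP[i _ ->]|x Sx].
  rewrite (leq_trans (msizeZ_le _ _)) // (leq_trans (msize_sum _ _ _)) //.
  apply/bigmax_leqP => k _; rewrite (leq_trans (msizeZ_le _ _)) //.
  have := dhomog_msize_le (dhomogMn k (linform_homog (u i))).
  by rewrite mul1n => /leq_trans; apply.
rewrite gE // big_map big_enum; apply: eq_bigr => i _ /=.
rewrite mevalZ exprMn sqr_sqrtr ?mulr_ge0 // mulrCA mulrC; congr (_ * _).
rewrite (horner_coef_wide _ sq) raddf_sum; congr (_ ^+ 2); apply: eq_bigr => k _ /=.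
rewrite mevalZ rmorphXn /= meval_linform; congr (_ * _ ^+ _).
by apply: eq_bigr => j _; rewrite mulrC.
Qed.

Lemma sos_on_sphere_ext (R : realType) (d l : nat) (g h : {mpoly R[d]}) :
  (forall x, sphere x -> g.@[x] = h.@[x]) -> sos_on_sphere l g -> sos_on_sphere l h.
Proof. by move=> gh [us sus gE]; exists us => // x Sx; rewrite -gh // gE. Qed.

(** Convolution with the kernel q(<x, z>) ^ 2, normalized to fix constants, sends
    nonnegative forms to l-sos ones and moves a form by O((d / l) ^ 2) in the
    uniform norm on the sphere: by reflection invariance the integrand h(z) - h(x)
    may be averaged over the reflection fixing x, which makes it of the order of
    1 - <x, z> ^ 2, and q is concentrated where this is small. *)
Lemma approx_identity (R : realType) (n : nat) :
  exists2 C : R, 0 <= C & forall d l, (1 < d)%N -> (8 * d <= l)%N -> (0 < n)%N ->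
  exists2 K : {mpoly R[d]} -> {mpoly R[d]},
    forall a x, sphere x -> (K (a *: sqnorm ^+ n)).@[x] = a &
    forall h, h \is n.*2.-homog ->
  [/\ K h \is n.*2.-homog,
      forall h', h' \is n.*2.-homog -> forall x, sphere x ->
        (K (h + h')).@[x] = (K h).@[x] + (K h').@[x],
      (forall x, sphere x -> 0 <= h.@[x]) -> sos_on_sphere l (K h) &
      forall B, (forall x, sphere x -> `|h.@[x]| <= B) -> forall x, sphere x ->
        `|(K h).@[x] - h.@[x]| <= C * (d%:R / l%:R) ^+ 2 * B].
Proof.
have [C C_ge0 CP] := reflection_mean_bound R n.
exists (72 * C) => [|d l d_ge2 ledl n_gt0]; first by rewrite mulr_ge0.
have [q [sq q_even qq_gt0 q_conc]] := @concentrated_zonal_poly R d d_ge2 l ledl.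
have [I [W [u design]]] := sphere_design_exists R (l + n) (ltnW d_ge2).
have [W_ge0 Su _ _ _] := design.
pose Q := q ^+ 2; have Q_even := even_sqr q_even.
have sQ : (size Q <= l.*2.+1)%N.
  rewrite (leq_trans (size_polyMleq _ _)) //.
  by move: (size q) sq => s; lia.
pose c := zonal_mean d Q; have c_gt0 : 0 < c := qq_gt0.
have K_ex h : exists g : {mpoly R[d]}, h \is n.*2.-homog -> g \is n.*2.-homog /\
    forall x, sphere x -> g.@[x] = c^-1 * expect W u (fun z => Q.[dotf x z] * h.@[z]).
  have [hh|] := boolP (h \is n.*2.-homog); last by exists 0.
  have [g hg gP] := design_kernel_homog design Q_even sQ hh (leqnn _).
  exists (c^-1 *: g) => _; split=> [|x Sx]; first by rewrite rpredZ.
  by rewrite mevalZ gP.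
have [K KP] := choice K_ex.
have Q_mean x : sphere x -> expect W u (fun z => Q.[dotf x z]) = c.
  by move=> Sx; rewrite (design_kernel_mean design Q_even sQ) // leq_addr.
exists K => [a x Sx|h hh].
  rewrite (KP _ (const_form_homog d n a)).2 //.
  rewrite (_ : expect _ _ _ = a * expect W u (fun z => Q.[dotf x z])).
    by rewrite Q_mean // mulrCA mulVf ?mulr1 // gt_eqF.
  rewrite -expectZ; apply: eq_bigr => i _; congr (_ * _).
  by rewrite (meval_const_form n a (Su i)) mulrC.
have [hK KE] := KP h hh.
split=> // [h' hh' x Sx|h_ge0|B hB x Sx].
- have [|_ ->] := KP (h + h') _ => //; first by rewrite rpredD.
  rewrite KE // (KP h' hh').2 // -mulrDr -expectD; congr (_ * _).
  by apply: eq_expect => z; rewrite mevalD mulrDr.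
- apply: (@kernel_sos _ _ _ _ W u q (fun z => c^-1 * h.@[z])) => // [i|x Sx].
    by rewrite mulr_ge0 ?invr_ge0 ?h_ge0 // ltW.
  rewrite KE // -expectZ; apply: eq_expect => z.
  by rewrite /Q horner_exp mulrCA.
have cE : c = expect W u (fun z => Q.[dotf x z]).
  by rewrite Q_mean.
have B_ge0 : 0 <= B by apply: le_trans (hB x Sx).
rewrite KE // -(ler_pM2l c_gt0) -[X in X * _ <= _]gtr0_norm // -normrM mulrBr.
rewrite mulrA divff ?gt_eqF // mul1r.
(* Reflection invariance replaces h z by its mean with the reflected value. *)
have -> : expect W u (fun z => Q.[dotf x z] * h.@[z]) - c * h.@[x] =
   expect W u (fun z => Q.[dotf x z] * ((h.@[z] + h.@[reflect_line x z]) / 2 - h.@[x])).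
  rewrite cE mulrC -expectZ.
  have r := design_kernel_reflect design Q_even sQ hh (leqnn _) Sx.
  rewrite [LHS](_ : _ = 2^-1 * (expect W u (fun z => Q.[dotf x z] * h.@[z]) +
     expect W u (fun z => Q.[dotf x z] * h.@[reflect_line x z]))
     - expect W u (fun z => h.@[x] * Q.[dotf x z])); last by rewrite r; field.
  rewrite -expectD -expectZ -expectB; apply: eq_expect => z; ring.
have Q_ge0 t : 0 <= Q.[t] by rewrite /Q horner_exp sqr_ge0.
apply: le_trans (_ : expect W u (fun z => C * B * ((1 - 'X^2) * Q).[dotf x z]) <= _).
  apply: le_trans (ler_norm_sum _ _ _) _; apply: ler_sum => i _.
  rewrite normrM ger0_norm // ler_wpM2l // normrM ger0_norm //.
  have -> : ((1 - 'X^2) * Q).[dotf x (u i)] = (1 - dotf x (u i) ^+ 2) * Q.[dotf x (u i)].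
    by rewrite hornerM hornerD hornerN hornerXn hornerC.
  rewrite [C * B * (_ * _)]mulrA [C * B * _ * _]mulrC.
  by rewrite ler_wpM2l // CP.
have sQ' : (size ((1 - 'X^2) * Q)%R <= l.+1.*2.+1)%N.
  rewrite (leq_trans (size_polyMleq _ _)) //.
  have : (size (1 - 'X^2 : {poly R})%R <= 3)%N.
    by rewrite (leq_trans (size_polyD _ _)) // size_polyN size_polyXn size_poly1.
  by move: (size _) (size Q) sQ => s1 s2; lia.
have Q_even' i : odd i -> ((1 - 'X^2) * Q)`_i = 0.
  move=> oi; rewrite mulrBl mul1r coefB Q_even // coefXnM.
  case: ltnP => le2i; first by rewrite subr0.
  by rewrite Q_even ?subr0 // oddB // oi.
rewrite expectZ (design_kernel_mean design Q_even' sQ') //; last by lia.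
have := ler_wpM2l (mulr_ge0 C_ge0 B_ge0) q_conc.
rewrite -/Q -/c => /le_trans; apply.
by rewrite le_eqVlt; apply/orP; left; apply/eqP; ring.
Qed.

(** * Closedness of the cone of sums of squares on the sphere *)

Local Open Scope classical_set_scope.

(** Choose nodes whose vectors of monomial values have maximal rank.  The vector
    of any other point of X is then a combination of these, with coefficients
    linear in its entries, hence polynomials of degree at most l. *)
Lemma interpolation_nodes (R : realType) (d l : nat) (X : set ('I_d -> R)) :
  exists (N : nat) (xs : 'I_N -> 'I_d -> R) (c : 'I_N -> {mpoly R[d]}),
  [/\ forall i, X (xs i), forall i, (msize (c i) <= l.+1)%N &
      forall u : {mpoly R[d]}, (msize u <= l.+1)%N -> forall x, X x ->
        u.@[x] = \sum_i u.@[xs i] * (c i).@[x]].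
Proof.
pose T := #|{: 'X_{1..d < l.+1}}|.
pose mon (j : 'I_T) : 'X_{1..d} := (enum_val j : 'X_{1..d < l.+1}).
pose ev (x : 'I_d -> R) : 'rV[R]_T := \row_j ('X_[mon j] : {mpoly R[d]}).@[x].
pose evs N (xs : 'I_N -> 'I_d -> R) : 'M[R]_(N, T) := \matrix_(i, j) ev (xs i) 0 j.
pose P r := `[< exists N (xs : 'I_N -> 'I_d -> R),
                  (forall i, X (xs i)) /\ \rank (evs N xs) = r >].
have exP : exists r, P r.
  exists (\rank (evs 0%N (fun _ _ => 0))); apply/asboolP.
  by exists 0%N, (fun _ _ => 0); split=> // -[].
have leP r : P r -> (r <= T)%N.
  by move/asboolP=> [N [xs [_ <-]]]; exact: rank_leq_col.
case: (ex_maxnP exP leP) => r /asboolP[N [xs [Xxs rk]]] rmax.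
have spans x : X x -> (ev x <= evs N xs)%MS.
  move=> Xx; pose ys (i : 'I_(1 + N)) := if split i is inr k then xs k else x.
  have eq_ys : evs _ ys = col_mx (ev x) (evs N xs).
    by apply/matrixP => i j; rewrite !mxE /ys; case: splitP => k _; rewrite ?ord1 !mxE.
  have /rmax : P (\rank (evs _ ys)).
    apply/asboolP; exists (1 + N)%N, ys; split=> // i.
    by rewrite /ys; case: splitP.
  rewrite eq_ys -rk => le_rk.
  have sub : (evs N xs <= col_mx (ev x) (evs N xs))%MS.
    by rewrite -addsmxE addsmxSr.
  have /eqmxP eqM : (evs N xs == col_mx (ev x) (evs N xs))%MS.
    by rewrite -(mxrank_leqif_eq sub) eqn_leq mxrankS.
  by rewrite eqM -addsmxE addsmxSl.
exists N, xs, (fun i => \sum_j pinvmx (evs N xs) j i *: 'X_[mon j]); split=> // [i|u su x Xx].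
  rewrite (leq_trans (msize_sum _ _ _)) //; apply/bigmax_leqP => j _.
  by rewrite (leq_trans (msizeZ_le _ _)) // msizeX ltnS -ltnS /mon; case: (enum_val j).
pose cu : 'cV[R]_T := \col_j u@_(mon j).
have evu y : u.@[y] = (ev y *m cu) 0 0.
  rewrite [u in LHS](mpolywE su) raddf_sum /= (reindex (fun j : 'I_T => enum_val j)) /=;
    last first.
    by apply: onW_bij; apply: enum_val_bij.
  by rewrite mxE; refine (eq_bigr _ _) => j _; rewrite !mxE mevalZ mulrC.
rewrite evu -(mulmxKpV (spans x Xx)) -(mulmxA (_ *m _)) mxE; apply: eq_bigr => i _.
rewrite mulrC; congr (_ * _); last first.
  rewrite mxE raddf_sum /=; apply: eq_bigr => j _.
  by rewrite mevalZ mxE mulrC.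
by rewrite evu !mxE; apply: eq_bigr => j _; rewrite !mxE.
Qed.

(** Cholesky factorization, as one column elimination per step: subtracting from
    M the projection on its first column a leaves a matrix with zero first
    column, and this projection has the Gram matrix of the single row
    a^T M / |a|.  When a = 0 the row vanishes since 1 / 0 = 0. *)
Lemma gram_square_factor (R : rcfType) (m n : nat) (M : 'M[R]_(m, n)) :
  exists L : 'M[R]_n, L^T *m L = M^T *m M.
Proof.
elim: n m M => [|n IH] m M; first by exists 0; apply/matrixP => -[].
pose a := lsubmx (M : 'M_(m, 1 + n)).
pose s : R := (a^T *m a) 0 0.
have s_sum : s = \sum_i a i 0 ^+ 2.
  by rewrite /s mxE; apply: eq_bigr => i _; rewrite mxE expr2.
have s_ge0 : 0 <= s by rewrite s_sum sumr_ge0 // => i _; rewrite sqr_ge0.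
have ata : a^T *m a = s%:M by apply/matrixP => i j; rewrite !ord1 [RHS]mxE eqxx mulr1n.
have a0 : s = 0 -> a = 0.
  rewrite s_sum => /eqP; rewrite psumr_eq0 => [/allP a0|i _]; last by rewrite sqr_ge0.
  apply/matrixP => i j; rewrite !ord1 [RHS]mxE; apply/eqP.
  by have := a0 i; rewrite mem_index_enum sqrf_eq0 /=; apply.
pose M' : 'M_(m, 1 + n) := M - s^-1 *: (a *m (a^T *m M)).
have aM' : lsubmx M' = 0.
  rewrite /M' linearB linearZ /= -mulmx_lsub -mulmx_lsub -/a ata.
  have [/a0 ->|s0] := eqVneq s 0; first by rewrite !mul0mx scaler0 subr0.
  by rewrite mul_mx_scalar scalerA mulVf // scale1r subrr.
have [L' eqL'] := IH m (rsubmx M').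
have eqM' : M' = row_mx 0 (rsubmx M') by rewrite -{1}[M']hsubmxK aM'.
pose L0 : 'M_(1, 1 + n) := Num.sqrt s^-1 *: (a^T *m M).
exists (col_mx L0 (row_mx 0 L') : 'M_(1 + n)).
have -> : (col_mx L0 (row_mx 0 L'))^T *m (col_mx L0 (row_mx 0 L'))
  = L0^T *m L0 + M'^T *m M'.
  rewrite tr_col_mx mul_row_col eqM' !tr_row_mx !mul_col_row eqL'.
  by rewrite !trmx0 !mul0mx !mulmx0.
have -> : L0^T *m L0 = s^-1 *: ((a^T *m M)^T *m (a^T *m M)).
  rewrite /L0 [(_ *: _)^T]linearZ /= -scalemxAl -scalemxAr scalerA -expr2 sqr_sqrtr //.
  by rewrite invr_ge0.
rewrite /M' [(_ - _)^T]linearB /= [(_ *: _)^T]linearZ /= mulmxBl !mulmxBr.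
set b := a^T *m M.
have -> : (a *m b)^T = b^T *m a^T by rewrite trmx_mul.
rewrite -!scalemxAl -!scalemxAr.
have -> : b^T *m a^T *m M = b^T *m b by rewrite /b mulmxA.
have -> : M^T *m (a *m b) = b^T *m b by rewrite mulmxA /b trmx_mul trmxK.
have -> : b^T *m a^T *m (a *m b) = s *: (b^T *m b).
  by rewrite mulmxA -(mulmxA b^T) ata mul_mx_scalar -scalemxAl.
have [s0|s0] := eqVneq s 0.
  by rewrite s0 invr0 !scale0r !subr0 add0r.
by rewrite [s^-1 *: (s *: _)]scalerA mulVf // scale1r subrr subr0 addrC subrK.
Qed.

Lemma ultra_bounded_cvg (R : realType) (I : Type) (F : set_system I) (f : I -> R) (B : R) :
  UltraFilter F -> (forall i, `|f i| <= B) -> exists l : R, f i @[i --> F] --> l.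
Proof.
move=> UF fB; have PF : ProperFilter F  by exact: ultra_proper.
have [|l [_ cl]] := @segment_compact R (- B) B (f i @[i --> F]) _.
  by apply: nearW => i; rewrite /= in_itv /= -ler_norml.
exists l => A nA.
have [//|FnA] := in_ultra_setVsetC (f @^-1` A) UF.
have [y [/= nAy Ay]] : ~` A `&` A !=set0 by apply: cl.
by [].
Qed.

Lemma cvg_big_sum (R : realType) (I : Type) (F : set_system I) (J : Type) (r : seq J)
    (f : J -> I -> R) (l : J -> R) :
  Filter F -> (forall j, f j i @[i --> F] --> l j) ->
  \sum_(j <- r) f j i @[i --> F] --> \sum_(j <- r) l j.
Proof.
move=> FF fl; elim: r => [|j r IH].
  by rewrite big_nil; under eq_cvg do rewrite big_nil; apply: cvg_cst.
rewrite big_cons; under eq_cvg do rewrite big_cons.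
by apply: cvgD.
Qed.

(** The cone of l-sos functions on the sphere is closed under pointwise limits.
    The values at interpolation nodes determine a polynomial of degree at most l on
    the sphere, so a sum of squares may be rewritten with as many squares as nodes
    and with coefficients L controlled by its own values at the nodes; these
    coefficients converge along an ultrafilter. *)
Lemma sos_on_sphere_closed (R : realType) (d l : nat) (g : nat -> {mpoly R[d]})
    (h : {mpoly R[d]}) :
  (forall k, sos_on_sphere l (g k)) ->
  (forall x, sphere x -> (g k).@[x] @[k --> \oo] --> h.@[x]) ->
  sos_on_sphere l h.
Proof.
move=> sos_g gh.
have [N [xs [c [Xxs sc interp]]]] := interpolation_nodes l (@sphere R d).
have factor k : exists L : 'M[R]_N,
    (forall x, sphere x -> (g k).@[x] = \sum_i (\sum_a L i a * (c a).@[x]) ^+ 2) /\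
    (forall a, \sum_i L i a ^+ 2 = (g k).@[xs a]).
  have [us sus eg] := sos_g k.
  pose M : 'M[R]_(size us, N) := \matrix_(j, a) (nth 0 us j).@[xs a].
  have [L eL] := gram_square_factor M; exists L; split=> [x Sx|a].
    rewrite eg //; pose v : 'cV[R]_N := \col_a (c a).@[x].
    have -> : \sum_i (\sum_a L i a * (c a).@[x]) ^+ 2 = (v^T *m (L^T *m L) *m v) 0 0.
      rewrite mulmxA -mulmxA -trmx_mul mxE; apply: eq_bigr => i _.
      rewrite mxE expr2; congr (_ * _); rewrite mxE.
        by apply: eq_bigr => a _; rewrite mxE.
      by apply: eq_bigr => a _; rewrite mxE.
    rewrite eL mulmxA -mulmxA -trmx_mul mxE (big_nth 0) big_mkord.
    apply: eq_bigr => j _; rewrite mxE -expr2; congr (_ ^+ 2).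
    rewrite (interp _ (sus _ (mem_nth 0 (ltn_ord j))) x Sx) mxE.
    by apply: eq_bigr => a _; rewrite !mxE.
  have /matrixP/(_ a a) := eL; rewrite !mxE.
  under eq_bigr do rewrite mxE -expr2.
  move=> ->; rewrite eg // (big_nth 0) big_mkord.
  by apply: eq_bigr => j _; rewrite !mxE expr2.
have [L LP] := choice factor.
have [F [UF Foo]] := @ultraFilterLemma nat \oo _.
have PF : ProperFilter F  by exact: ultra_proper.
have lim i a : exists lia : R, L k i a @[k --> F] --> lia.
  have /cvg_seq_bounded : cvgn (fun k => (g k).@[xs a]) by apply/cvg_ex; eexists; apply: gh.
  move=> [M [_ /(_ (`|M| + 1))]]; rewrite (le_lt_trans (ler_norm M)) ?ltrDl //.
  move=> /(_ isT) Mb.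
  apply: (@ultra_bounded_cvg _ _ _ _ (`|M| + 1 + 1)) => // k.
  have M1 : 0 <= `|M| by [].
  rewrite -(ler_pXn2r (ltn0Sn 1)) ?nnegrE ?addr_ge0 // real_normK ?num_real //.
  have le1 : L k i a ^+ 2 <= (g k).@[xs a].
    have [_ <-] := LP k; rewrite (bigD1 i) //= lerDl sumr_ge0 // => j _.
    exact: sqr_ge0.
  have := Mb k I => /= Mbk.
  have := ler_norm (g k).@[xs a]; nra.
pose Ls i a := sval (cid (lim i a)).
have LsP i a : L k i a @[k --> F] --> Ls i a := svalP (cid (lim i a)).
exists [seq \sum_a Ls i a *: c a | i <- enum 'I_N] => [u /mapP[i _ ->]|x Sx].
  rewrite (leq_trans (msize_sum _ _ _)) //; apply/bigmax_leqP => a _.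
  by rewrite (leq_trans (msizeZ_le _ _)).
rewrite big_map big_enum /=.
have l1 : (g k).@[x] @[k --> F] --> h.@[x].
  by move=> A /(gh x Sx) /Foo.
have l2 : (g k).@[x] @[k --> F] --> \sum_i (\sum_a Ls i a * (c a).@[x]) ^+ 2.
  under eq_cvg => k do rewrite (LP k).1 //.
  apply: cvg_big_sum => i; rewrite expr2; under eq_cvg do rewrite expr2.
  by apply: cvgM; apply: cvg_big_sum => a; apply: cvgM;
    [exact: LsP|exact: cvg_cst|exact: LsP|exact: cvg_cst].
rewrite (cvg_unique _ l1 l2) //; apply: eq_bigr => i _.
by rewrite raddf_sum /=; congr (_ ^+ 2); apply: eq_bigr => a _; rewrite mevalZ.
Qed.

(** The set of admissible gamma is closed, by the closedness of the sos cone, and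
    bounded below by the values of p. *)
Lemma sos_bound_attained (R : realType) (d l : nat) (p : {mpoly R[d]}) (a : R)
    (x0 : 'I_d -> R) :
  sphere x0 -> sos_on_sphere l (a%:MP - p) -> exists pl, is_sos_bound l p pl.
Proof.
move=> Sx0 sos_a; pose Gam : set R := [set gamma | sos_on_sphere l (gamma%:MP - p)].
have lbG : lbound Gam p.@[x0].
  move=> g [us _ /(_ x0 Sx0)]; rewrite mevalB mevalC => E.
  by rewrite -subr_ge0 E sumr_ge0 // => u _; rewrite sqr_ge0.
have infG : has_inf Gam by split; [exists a|exists p.@[x0]].
exists (inf Gam); split; last exact: ge_inf infG.2.
have adh k : exists g, Gam g /\ g < inf Gam + k.+1%:R^-1.
  have k0 : 0 < k.+1%:R^-1 :> R by rewrite invr_gt0.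
  by have [g Gg lt_g] := inf_adherent k0 infG; exists g.
have [g gP] := choice adh.
have g_cvg : g k @[k --> \oo] --> inf Gam.
  apply: (@squeeze_cvgr _ _ _ _ (fun=> inf Gam) (fun k => inf Gam + k.+1%:R^-1)).
  - near=> k; have [Gg lt_g] := gP k.
    by rewrite (ge_inf infG.2 Gg) ltW.
  - exact: cvg_cst.
  - rewrite -[X in _ --> X]addr0; apply: cvgD; first exact: cvg_cst.
    exact: cvg_harmonic.
apply: (@sos_on_sphere_closed _ _ _ (fun k => (g k)%:MP - p)) => [k|x Sx].
  by have [] := gP k.
rewrite mevalB mevalC; under eq_cvg do rewrite mevalB mevalC.
by apply: cvgB => //; exact: cvg_cst.
Unshelve. all: by end_near.
Qed.

(** * The Neumann series and the rate of convergence *)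

(** K is not inverted; the Neumann series s m of its inverse at F satisfies
    K (s m) = F - e m.+1 with e m.+1 of size delta ^ m.+1, and
    s m >= F - 2 delta D >= - 2 delta D, so that F + 2 delta D is a limit of
    images under K of nonnegative forms. *)
Lemma sos_of_nonneg_add (R : realType) (n : nat) : (0 < n)%N ->
  exists2 C : R, 0 <= C & forall d l (F : {mpoly R[d]}) (D : R),
    (1 < d)%N -> (8 * d <= l)%N -> F \is n.*2.-homog ->
    (forall x, sphere x -> 0 <= F.@[x] <= D) ->
    let delta := C * (d%:R / l%:R) ^+ 2 in delta <= 1 / 2 ->
    sos_on_sphere l (F + (2 * delta * D) *: sqnorm ^+ n).
Proof.
move=> n_gt0; have [C C_ge0 CP] := approx_identity R n.
exists C => // d l F D d_ge2 ledl hF FD delta delta_le.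
have [K K1 KP] := CP d l d_ge2 ledl n_gt0.
have delta_ge0 : 0 <= delta by rewrite mulr_ge0 // sqr_ge0.
pose e i := iter i (fun g => g - K g) F.
have he i : e i \is n.*2.-homog.
  elim: i => [//|i IH]; have [hK _ _ _] := KP _ IH.
  by rewrite /e iterS rpredB.
have e_le i x : sphere x -> `|(e i).@[x]| <= delta ^+ i * D.
  elim: i x => [|i IH] x Sx.
    by have /andP[F0 F1] := FD x Sx; rewrite expr0 mul1r ger0_norm.
  have [_ _ _ /(_ _ IH x Sx) le_e] := KP _ (he i).
  by rewrite [e i.+1]iterS mevalB distrC exprS -mulrA.
pose s m := iteri m (fun i g => g + e i.+1) F.
have sS m : s m.+1 = s m + e m.+1 by [].
have hs m : s m \is n.*2.-homog.
  by elim: m => [//|m IH]; rewrite sS rpredD.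
have Ks m x : sphere x -> (K (s m)).@[x] = F.@[x] - (e m.+1).@[x].
  move=> Sx; elim: m => [|m IH]; first by rewrite /e /= mevalB; ring.
  have [_ Kadd _ _] := KP _ (hs m).
  by rewrite sS Kadd // IH [e m.+2]iterS mevalB; ring.
have s_ge m x : sphere x -> - ((2 * delta - 2 * delta ^+ m.+1) * D) <= (s m).@[x].
  move=> Sx; have D_ge0 : 0 <= D by have /andP[F0 /(le_trans F0)] := FD x Sx.
  elim: m => [|m IH].
    by rewrite expr1 subrr mul0r oppr0; have /andP[] := FD x Sx.
  have := e_le m.+1 x Sx; rewrite ler_norml => /andP[el _].
  rewrite sS mevalD.
  have : 0 <= (1 - 2 * delta) * (delta ^+ m.+1 * D).
    rewrite mulr_ge0 //; first by lra.
    by rewrite mulr_ge0 // exprn_ge0.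
  by rewrite [delta ^+ m.+2]exprS; move: (delta ^+ m.+1) IH el => a; nra.
apply: (@sos_on_sphere_closed _ _ _ (fun m => K (s m + (2 * delta * D) *: sqnorm ^+ n))).
  move=> m; have [|_ _ Ksos _] := KP (s m + (2 * delta * D) *: sqnorm ^+ n) _.
    by rewrite rpredD // const_form_homog.
  apply: Ksos => x Sx; rewrite mevalD meval_const_form //.
  have D_ge0 : 0 <= D by have /andP[F0 /(le_trans F0)] := FD x Sx.
  have := s_ge m x Sx.
  have : 0 <= delta ^+ m.+1 * D by rewrite mulr_ge0 // exprn_ge0.
  by move: (delta ^+ m.+1) => a; lra.
move=> x Sx; rewrite mevalD meval_const_form //.
have e0 : (e m.+1).@[x] @[m --> \oo] --> (0 : R).
  apply/norm_cvg0P.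
  apply: (@squeeze_cvgr _ _ _ _ (fun=> 0) (fun m => (1 / 2) ^+ m * D)).
  - near=> m; rewrite normr_ge0 /= (le_trans (e_le m.+1 x Sx)) //.
    have D_ge0 : 0 <= D by have /andP[F0 /(le_trans F0)] := FD x Sx.
    rewrite ler_wpM2r // exprS (@le_trans _ _ (delta ^+ m)) //.
      by rewrite ler_piMl ?exprn_ge0 //; lra.
    by rewrite lerXn2r ?nnegrE //; lra.
  - exact: cvg_cst.
  - rewrite -[X in _ --> X](mul0r D); apply: cvgMl.
    by apply: cvg_expr; rewrite ger0_norm //; lra.
have -> : (fun m => (K (s m + (2 * delta * D) *: sqnorm ^+ n)).@[x]) =
    (fun m => F.@[x] + 2 * delta * D - (e m.+1).@[x]).
  apply: funext => m; have [_ Kadd _ _] := KP _ (hs m).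
  by rewrite Kadd ?const_form_homog // Ks // K1 //; ring.
rewrite -[X in _ --> X]subr0; apply: cvgB => //; exact: cvg_cst.
Unshelve. all: by end_near.
Qed.

Lemma meval_dim1 (R : realType) (n : nat) (p : {mpoly R[1]}) (x y : 'I_1 -> R) :
  p \is n.*2.-homog -> sphere x -> sphere y -> p.@[x] = p.@[y].
Proof.
move=> hp; rewrite /sphere /= !big_ord1 => x1 y1.
have -> : p.@[x] = p.@[fun i => (x ord0 * y ord0) * y i].
  by apply: meval_eq => i; rewrite ord1 -mulrA -expr2 y1 mulr1.
by rewrite (meval_homog_scale _ _ hp) -mul2n exprM (exprMn 2) x1 y1 mulr1 expr1n mul1r.
Qed.

Local Close Scope classical_set_scope.

Theorem theorem1 (R : realType) (n : nat) (hn : (1 <= n)%N) :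
  exists2 C : R, 0 < C &
    forall (d : nat) (p : {mpoly R[d]}) (pmin pmax : R),
      (n <= d)%N ->
      p \is (2 * n)%N.-homog ->
      is_min (sphere_values p) pmin ->
      is_max (sphere_values p) pmax ->
      pmin < pmax ->
      forall l : nat, C * d%:R <= l%:R ->
        exists2 pl : R, is_sos_bound l p pl &
          1 <= (pl - pmin) / (pmax - pmin) <= 1 + (C * d%:R / l%:R) ^+ 2.
Proof.
have [C C_ge0 CP] := sos_of_nonneg_add R hn.
(* With this constant, l >= 8 d, delta = C (d / l) ^ 2 <= 1/2, and 2 delta is at most
   the square in the conclusion. *)
exists (12 * (C + 1)) => [|d p pmin pmax led hp [[x0 Sx0 px0] minP] [[x1 Sx1 px1] maxP]
  ltp l lel].
  by rewrite mulr_gt0 // ltr_wpDl.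
have {}hp : p \is n.*2.-homog by rewrite -mul2n.
(* For d = 1, forms of even degree are constant on the sphere {1, -1}. *)
have d_ge2 : (1 < d)%N.
  case: d p led hp minP maxP x0 Sx0 px0 x1 Sx1 px1 lel => [|[|d]] // p led hp.
    by move: (leq_trans hn led).
  move=> _ _ x0 Sx0 px0 x1 Sx1 px1.
  by move: ltp; rewrite -px0 -px1 (meval_dim1 hp Sx0 Sx1) ltxx.
have d0 : 0 < d%:R :> R by rewrite ltr0n ltnW.
have l0 : 0 < l%:R :> R by apply: lt_le_trans lel; rewrite mulr_gt0 // mulr_gt0 // ltr_wpDl.
have ledl : (8 * d <= l)%N.
  rewrite -(ler_nat R) natrM (le_trans _ lel) // ler_wpM2r //; lra.
pose r : R := d%:R / l%:R.
have r_ge0 : 0 <= r by rewrite divr_ge0.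
have r_le : 12 * (C + 1) * r <= 1 by rewrite /r mulrA ler_pdivrMr // mul1r.
have delta_le : C * r ^+ 2 <= 1 / 2.
  have r12_ge0 : 0 <= 12 * (C + 1) * r.
    by apply: mulr_ge0 => //; apply: mulr_ge0 => //; apply: addr_ge0.
  have r1 : (12 * (C + 1) * r) ^+ 2 <= 1 by apply: exprn_ile1.
  by have := sqr_ge0 r; nra.
pose F : {mpoly R[d]} := pmax *: sqnorm ^+ n - p.
have hF : F \is n.*2.-homog.
  by rewrite rpredB // const_form_homog.
have FE x : sphere x -> F.@[x] = pmax - p.@[x].
  by move=> Sx; rewrite mevalB meval_const_form.
have FD x : sphere x -> 0 <= F.@[x] <= pmax - pmin.
  move=> Sx; rewrite FE // subr_ge0 lerD2l lerN2.
  by rewrite maxP ?minP //; exists x.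
have sosF := CP d l F (pmax - pmin) d_ge2 ledl hF FD delta_le.
pose gamma := pmax + 2 * (C * r ^+ 2) * (pmax - pmin).
have sos_gamma : sos_on_sphere l (gamma%:MP - p).
  apply: sos_on_sphere_ext sosF => x Sx.
  rewrite mevalD meval_const_form // FE // mevalB mevalC.
  by rewrite /gamma /r; ring.
have [pl plP] := sos_bound_attained Sx1 sos_gamma.
exists pl => //; have [[us _ usE] pl_min] := plP.
have pl_ge : pmax <= pl.
  rewrite -px1 -subr_ge0; have := usE x1 Sx1; rewrite mevalB mevalC => ->.
  by rewrite sumr_ge0 // => u _; rewrite sqr_ge0.
have pl_le : pl <= gamma by apply: pl_min.
have D0 : 0 < pmax - pmin by rewrite subr_gt0.
rewrite ler_pdivlMr // mul1r lerD2r pl_ge /= ler_pdivrMr //.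
rewrite -mulrA -/r exprMn.
apply: le_trans (_ : (1 + 2 * (C * r ^+ 2)) * (pmax - pmin) <= _).
  by move: pl_le; rewrite /gamma; lra.
rewrite ler_wpM2r ?(ltW D0) // lerD2l.
have := sqr_ge0 r; nra.
Qed.
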